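(* Let $r\in\{1,2,\ldots,\infty\}$, let $\mathcal{D}$ be the group of orientation-preserving $C^r$-diffeomorphisms of $\mathbb{R}_{pos}=(0,+\infty)$, and let $\mathcal{W}\subset\mathcal{D}$ be its subgroup consisting of those diffeomorphisms which can be extended to a $C^r$-diffeomorphism of $\mathbb{R}$. Then there is a canonical bijection between - isomorphism classes (i.e. classes up to $C^r$-diffeomorphism) of $C^r$-structures on the non-Hausdorff manifold $\mathbb{Y}$, and - $(\mathcal{W},\pm)$-double cosets $\mathcal{W}\setminus\mathcal{D}^{\pm1}/\mathcal{W}$. In particular, $\mathbb{Y}$ admits uncountably many pairwise non-diffeomorphic $C^r$-structures.
   Context: $\mathbb{Y}=(\mathbb{R}\times\{0,1\})/\{(x,0)\sim(x,1),\ x>0\}$ with the quotient topology (two copies of $\mathbb{R}$ glued by the identity of $\mathbb{R}_{pos}$); $\pi:\mathbb{R}\times\{0,1\}\to\mathbb{Y}$ is the quotient map, $U=\pi(\mathbb{R}\times\{0\})$, $V=\pi(\mathbb{R}\times\{1\})$, $W=U\cap V=\pi(\mathbb{R}_{pos}\times\{0\})$. Manifolds are not assumed to be Hausdorff. A $C^r$-atlas on $\mathbb{Y}$ is a family of charts (homeomorphisms from open subsets of $\mathbb{Y}$ onto open subsets of $\mathbb{R}$) whose domains cover $\mathbb{Y}$ and whose transition maps are $C^r$-diffeomorphisms; a $C^r$-structure is a maximal $C^r$-atlas. Two $C^r$-structures $\mathfrak{A},\mathfrak{B}$ are isomorphic ($C^r$-diffeomorphic) if there is a homeomorphism $h:\mathbb{Y}\to\mathbb{Y}$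 such that all coordinate representations of $h$ and $h^{-1}$ with respect to $\mathfrak{A}$ and $\mathfrak{B}$ are $C^r$. For a subgroup $\mathcal{W}$ of a group $\mathcal{D}$, the $(\mathcal{W},\pm)$-double coset of $g\in\mathcal{D}$ is the set $\mathcal{W}g\mathcal{W}\cup\mathcal{W}g^{-1}\mathcal{W}$; these sets partition $\mathcal{D}$, and the set of all of them is denoted $\mathcal{W}\setminus\mathcal{D}^{\pm1}/\mathcal{W}$. The canonical bijection is the one induced by transition maps: a $C^r$-structure containing an atlas consisting of two charts $\phi:U\to\mathbb{R}$, $\psi:V\to\mathbb{R}$ which are homeomorphisms onto $\mathbb{R}$ with $\phi(W)=\psi(W)=\mathbb{R}_{pos}$ is sent to the class of $\psi\circ\phi^{-1}|_{\mathbb{R}_{pos}}\in\mathcal{D}$. *)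

(* Defs.v *)
From HB Require Import structures.
From mathcomp Require Import all_boot all_order all_algebra.
From mathcomp Require Import all_classical all_reals all_analysis.

Set Implicit Arguments.
Unset Strict Implicit.
Unset Printing Implicit Defensive.

Import Order.TTheory GRing.Theory Num.Theory.
Import numFieldNormedType.Exports.

Local Open Scope ring_scope.
Local Open Scope classical_set_scope.

(* An order of differentiability: [Some n] is C^n and [None] is C^infinity.   *)
Definition diff_order := option nat.

(* Maps between subsets of R are total functions R -> R of which only the
   values on the (open) domain matter. *)
Section Smoothness.
Context {R : realType}.
Implicit Types (A B : set R) (f g : R -> R) (n : nat) (r : diff_order).

Definition Cn_on n A f : Prop :=
  (forall i, (i < n)%N -> forall x, A x -> derivable (f^`(i)) x 1) /\
  {in A, continuous (f^`(n))}.

Definition Cr_on r A f : Prop :=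
  if r is Some n then Cn_on n A f else forall n, Cn_on n A f.

Definition Cr_diffeo r A B f g : Prop :=
  [/\ set_fun A B f, set_fun B A g,
      {in A, cancel f g}, {in B, cancel g f} &
      Cr_on r A f /\ Cr_on r B g].

Lemma Cn_onS n A f :
  Cn_on n.+1 A f <-> (forall x, A x -> derivable f x 1) /\ Cn_on n A (f^`()).
Proof.
split=> [[df cf]|[df [ddf cf]]].
  split; first exact: (df 0%N).
  split; last by rewrite -derive1Sn.
  by move=> i ltin x Ax; rewrite -derive1Sn; apply: df.
split; last by rewrite derive1Sn.
case=> [_|i ltin] x Ax; first exact: df.
by rewrite derive1Sn; apply: ddf.
Qed.

Lemma open_near_eq A f g x : open A -> {in A, f =1 g} -> A x ->
  {near x, f =1 g}.
Proof.
move=> oA fg Ax; have : nbhs x A by apply: open_nbhs_nbhs.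
by apply: filterS => y Ay; apply: fg; rewrite inE.
Qed.

Lemma eq_Cn_on n A f g : open A -> {in A, f =1 g} -> Cn_on n A f -> Cn_on n A g.
Proof.
move=> oA; elim: n f g => [|n IHn] f g fg.
  move=> [_ cf]; split=> // x xA; have Ax := set_mem xA.
  have fgx := open_near_eq oA fg Ax.
  rewrite /continuous_at /= -(fg _ xA).
  by apply: cvg_trans (cf _ xA); exact: near_eq_cvg.
move=> /Cn_onS[df Cf]; apply/Cn_onS; split=> [x Ax|].
  exact: near_eq_derivable (open_near_eq oA fg Ax) (df x Ax).
apply: IHn Cf => x xA; rewrite !derive1E; apply: near_eq_derive.
exact: open_near_eq oA fg (set_mem xA).
Qed.

Lemma derivable_in_continuous A f :
  (forall x, A x -> derivable f x 1) -> {in A, continuous f}.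
Proof.
move=> df x /set_mem Ax; apply/differentiable_continuous.
by rewrite -derivable1_diffP; apply: df.
Qed.

Lemma Cn_onW n A f : Cn_on n.+1 A f -> Cn_on n A f.
Proof.
move=> [df _]; split=> [i ltin|]; first by apply: df; apply: ltnW.
exact/derivable_in_continuous/df.
Qed.

Lemma Cn_on_cst n A (c : R) : Cn_on n A (cst c).
Proof.
elim: n c => [|n IHn] c; first by split=> // x _; exact: cvg_cst.
apply/Cn_onS; split=> [x _|]; first exact: derivable_cst.
suff -> : (cst c)^`() = cst 0 :> (R -> R) by exact: IHn.
by apply/funext => x; rewrite derive1_cst.
Qed.

Lemma Cn_on_id n A : Cn_on n A id.
Proof.
case: n => [|n]; first by split=> // x _; exact: cvg_id.
apply/Cn_onS; split=> [x _|]; first exact: derivable_id.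
suff -> : (id : R -> R)^`() = cst 1 by exact: Cn_on_cst.
by apply/funext => x; rewrite derive1_id.
Qed.

Lemma Cn_on_add n A f g : open A ->
  Cn_on n A f -> Cn_on n A g -> Cn_on n A (f + g).
Proof.
move=> oA; elim: n f g => [|n IHn] f g.
  move=> [_ cf] [_ cg]; split=> // x xA.
  by apply: (@cvgD _ R^o); [exact: cf|exact: cg].
move=> /Cn_onS[df Cf] /Cn_onS[dg Cg]; apply/Cn_onS; split=> [x Ax|].
  by apply: derivableD; [exact: df|exact: dg].
apply: eq_Cn_on (IHn _ _ Cf Cg) => // x /set_mem Ax.
by rewrite [RHS]derive1E deriveD ?[LHS]/(_ + _) ?derive1E//; [exact: df|exact: dg].
Qed.

Lemma Cn_on_mul n A f g : open A ->
  Cn_on n A f -> Cn_on n A g -> Cn_on n A (f * g).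
Proof.
move=> oA; elim: n f g => [|n IHn] f g.
  move=> [_ cf] [_ cg]; split=> // x xA.
  by apply: cvgM; [exact: cf|exact: cg].
move=> Cf Cg; have /Cn_onS[df Cdf] := Cf; have /Cn_onS[dg Cdg] := Cg.
apply/Cn_onS; split=> [x Ax|].
  by apply: derivableM; [exact: df|exact: dg].
have e : {in A, f * derive1 g + g * derive1 f =1 (f * g)^`()}.
  move=> x /set_mem Ax.
  by rewrite [RHS]derive1E deriveM -?derive1E//; [exact: df|exact: dg].
by apply: (eq_Cn_on oA e); apply: Cn_on_add => //; apply: IHn => //; exact: Cn_onW.
Qed.

Lemma Cn_on_comp n A B f g : open A -> open B -> set_fun A B f ->
  Cn_on n A f -> Cn_on n B g -> Cn_on n A (g \o f).
Proof.
move=> oA oB AB; elim: n g => [|n IHn] g.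
  move=> [_ cf] [_ cg]; split=> // x xA.
  apply: continuous_comp; first exact: cf.
  by apply: cg; rewrite inE; apply: AB; exact: set_mem.
move=> Cf /Cn_onS[dg Cdg]; have /Cn_onS[df Cdf] := Cf.
apply/Cn_onS; split=> [x Ax|].
  apply/derivable1_diffP/differentiable_comp; apply/derivable1_diffP.
    exact: df.
  exact/dg/AB.
have e : {in A, (derive1 g \o f) * derive1 f =1 (g \o f)^`()}.
  move=> x /set_mem Ax.
  by rewrite derive1_comp//; [exact: df|exact/dg/AB].
by apply: (eq_Cn_on oA e); apply: Cn_on_mul => //; apply: IHn => //; exact: Cn_onW.
Qed.

Lemma Cr_on_id r A : Cr_on r A id.
Proof. by case: r => [n|n]; exact: Cn_on_id. Qed.

Lemma eq_Cr_on r A f g : open A -> {in A, f =1 g} -> Cr_on r A f -> Cr_on r A g.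
Proof.
by move=> oA fg; case: r => [n|Cf n]; [|move: (Cf n)]; exact: eq_Cn_on.
Qed.

Lemma Cr_on_comp r A B f g : open A -> open B -> set_fun A B f ->
  Cr_on r A f -> Cr_on r B g -> Cr_on r A (g \o f).
Proof.
move=> oA oB AB; case: r => [n|Cf Cg n]; first exact: Cn_on_comp.
exact: Cn_on_comp (Cf n) (Cg n).
Qed.

End Smoothness.

Definition Rpos (R : realType) : set R := [set x | 0 < x].
Definition posR (R : realType) := {x : R | 0 < x}.

(* A self-map of R_pos as a map R -> R, with value 0 off R_pos. *)
Definition ext_pos (R : realType) (f : posR R -> posR R) (x : R) : R :=
  oapp (fun u => val (f u)) 0 (insub x).

(* The group D; [g * h] is the composite g \o h. *)
Record posdiffeo (R : realType) (r : diff_order) := PosDiffeo {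
  pd_fun :> posR R -> posR R;
  pd_inv : posR R -> posR R;
  pd_funK : cancel pd_fun pd_inv;
  pd_invK : cancel pd_inv pd_fun;
  pd_fun_Cr : Cr_on r (@Rpos R) (ext_pos pd_fun);
  pd_inv_Cr : Cr_on r (@Rpos R) (ext_pos pd_inv);
  pd_orientation : forall u v, val u < val v -> val (pd_fun u) < val (pd_fun v)
}.

Section PosDiffeoGroup.
Context {R : realType} {r : diff_order}.
Implicit Types f g h : posdiffeo R r.

Lemma posdiffeo_eq f g : pd_fun f =1 pd_fun g -> f = g.
Proof.
move=> /funext fg.
have fgV : pd_inv f = pd_inv g.
  by apply/funext => x; rewrite -{1}(pd_invK g x) -fg pd_funK.
case: f g fg fgV => [a b p1 p2 p3 p4 p5] [c d q1 q2 q3 q4 q5] /= ac bd.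
by subst c d; congr PosDiffeo; exact: Prop_irrelevance.
Qed.

Lemma open_Rpos : open (@Rpos R).
Proof. exact: open_gt. Qed.

Lemma ext_pos_val (f : posR R -> posR R) u : ext_pos f (val u) = val (f u).
Proof. by rewrite /ext_pos valK. Qed.

Lemma Rpos_val (x : R) : Rpos x -> exists u : posR R, x = val u.
Proof. by move=> x0; exists (Sub x x0); rewrite SubK. Qed.

Lemma ext_pos_fun (f : posR R -> posR R) : set_fun (@Rpos R) (@Rpos R) (ext_pos f).
Proof. by move=> _ /Rpos_val[u ->]; rewrite ext_pos_val; exact: valP. Qed.

Lemma ext_pos_id_Cr : Cr_on r (@Rpos R) (ext_pos id).
Proof.
apply: eq_Cr_on (Cr_on_id _ _); first exact: open_Rpos.
by move=> _ /set_mem/Rpos_val[u ->]; rewrite ext_pos_val.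
Qed.

Lemma ext_pos_comp_Cr (f g : posR R -> posR R) :
  Cr_on r (@Rpos R) (ext_pos f) -> Cr_on r (@Rpos R) (ext_pos g) ->
  Cr_on r (@Rpos R) (ext_pos (f \o g)).
Proof.
move=> Cf Cg; have oP := open_Rpos.
apply: eq_Cr_on (Cr_on_comp oP oP (ext_pos_fun g) Cg Cf) => //.
by move=> _ /set_mem/Rpos_val[u ->] /=; rewrite !ext_pos_val.
Qed.

Definition pd_one : posdiffeo R r :=
  @PosDiffeo R r id id (fun=> erefl) (fun=> erefl)
    ext_pos_id_Cr ext_pos_id_Cr (fun u v uv => uv).

Definition pd_mul f g : posdiffeo R r :=
  @PosDiffeo R r (f \o g) (pd_inv g \o pd_inv f)
    (can_comp (@pd_funK _ _ f) (@pd_funK _ _ g))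
    (can_comp (@pd_invK _ _ g) (@pd_invK _ _ f))
    (ext_pos_comp_Cr (@pd_fun_Cr _ _ f) (@pd_fun_Cr _ _ g))
    (ext_pos_comp_Cr (@pd_inv_Cr _ _ g) (@pd_inv_Cr _ _ f))
    (fun u v uv => pd_orientation f (pd_orientation g uv)).

Lemma pd_inv_orientation f (u v : posR R) :
  val u < val v -> val (pd_inv f u) < val (pd_inv f v).
Proof.
move=> uv; rewrite ltNge le_eqVlt; apply/negP => /orP[/eqP/val_inj|/pd_orientation].
  by move/(congr1 (pd_fun f)); rewrite !pd_invK => vu; rewrite vu ltxx in uv.
by move/(_ _ f); rewrite !pd_invK ltNge (ltW uv).
Qed.

Definition pd_inverse f : posdiffeo R r :=
  @PosDiffeo R r (pd_inv f) f (@pd_invK _ _ f) (@pd_funK _ _ f)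
    (@pd_inv_Cr _ _ f) (@pd_fun_Cr _ _ f) (@pd_inv_orientation f).

HB.instance Definition _ := gen_eqMixin (posdiffeo R r).
HB.instance Definition _ := gen_choiceMixin (posdiffeo R r).

Lemma pd_mulA : associative pd_mul.
Proof. by move=> f g h; apply: posdiffeo_eq. Qed.
Lemma pd_mul1 : left_id pd_one pd_mul.
Proof. by move=> f; apply: posdiffeo_eq. Qed.
Lemma pd_1mul : right_id pd_one pd_mul.
Proof. by move=> f; apply: posdiffeo_eq. Qed.
Lemma pd_mulV : left_inverse pd_one pd_inverse pd_mul.
Proof. by move=> f; apply: posdiffeo_eq => x /=; rewrite pd_funK. Qed.
Lemma pd_Vmul : right_inverse pd_one pd_inverse pd_mul.
Proof. by move=> f; apply: posdiffeo_eq => x /=; rewrite pd_invK. Qed.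

HB.instance Definition _ :=
  isGroup.Build (posdiffeo R r) pd_mulA pd_mul1 pd_1mul pd_mulV pd_Vmul.

End PosDiffeoGroup.

(* The subgroup W of D. *)
Definition extendable (R : realType) (r : diff_order) : set (posdiffeo R r) :=
  [set w | exists F G : R -> R,
     Cr_diffeo r setT setT F G /\ forall u, F (val u) = val (w u)].

Definition pm_double_coset (G : groupType) (W : set G) (g : G) : set G :=
  [set (w1 * g * w2)%g | w1 in W & w2 in W] `|`
  [set (w1 * g^-1 * w2)%g | w1 in W & w2 in W].

Definition pm_double_cosets (G : groupType) (W : set G) : set (set G) :=
  range (pm_double_coset W).

Definition homeo (S T : topologicalType) (A : set S) (B : set T)
    (f : S -> T) (g : T -> S) : Prop :=
  [/\ set_fun A B f, set_fun B A g,
      {in A, cancel f g}, {in B, cancel g f} &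
      {within A, continuous f} /\ {within B, continuous g}].

Section Structures.
Context {R : realType} (M : topologicalType).

Record chart := Chart {
  chart_dom : set M;
  chart_cod : set R;
  chart_fun :> M -> R;
  chart_inv : R -> M;
  chart_dom_open : open chart_dom;
  chart_cod_open : open chart_cod;
  chart_homeo : homeo chart_dom chart_cod chart_fun chart_inv
}.

Implicit Types (phi psi : chart) (A B : set chart) (r : diff_order).

Definition Cr_compatible r phi psi : Prop :=
  let D := chart_dom phi `&` chart_dom psi in
  Cr_diffeo r (phi @` D) (psi @` D)
    (psi \o chart_inv phi) (phi \o chart_inv psi).

Definition is_Cr_atlas r A : Prop :=
  (forall x : M, exists2 phi, A phi & chart_dom phi x) /\
  (forall phi psi, A phi -> A psi -> Cr_compatible r phi psi).

(* Two charts that agree on their common domain but have different junk values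
   are compatible with the same charts, so a maximal atlas contains both or
   neither: junk values do not produce additional structures. *)
Definition Cr_structures r : set (set chart) :=
  [set A | is_Cr_atlas r A /\
           forall B, is_Cr_atlas r B -> A `<=` B -> B = A].

Definition Cr_map r A B (h : M -> M) : Prop :=
  forall phi psi, A phi -> B psi ->
    Cr_on r (phi @` (chart_dom phi `&` h @^-1` chart_dom psi))
      (psi \o h \o chart_inv phi).

Definition Cr_isomorphic r A B : Prop :=
  exists h k : M -> M,
    [/\ homeo setT setT h k, Cr_map r A B h & Cr_map r B A k].

Definition Cr_iso_class r A : set (set chart) :=
  [set B | Cr_structures r B /\ Cr_isomorphic r A B].

Definition Cr_iso_classes r : set (set (set chart)) :=
  Cr_iso_class r @` Cr_structures r.

End Structures.
Arguments chart R M : clear implicits.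
Arguments Cr_structures R M r : clear implicits.
Arguments Cr_iso_classes R M r : clear implicits.

(* The copies R x {0} and R x {1} are indexed by false and true; in R * bool
   the topology of bool is the discrete one. *)
Section GluedLines.
Local Open Scope quotient_scope.
Variable R : realType.

Definition glued (p q : R * bool) : bool :=
  (p.1 == q.1) && ((p.2 == q.2) || (0 < p.1)).

Lemma glued_refl : reflexive glued.
Proof. by move=> p; rewrite /glued !eqxx. Qed.

Lemma glued_sym : symmetric glued.
Proof.
by move=> p q; rewrite /glued (eq_sym p.2); case: eqVneq => [->|] //=.
Qed.

Lemma glued_trans : transitive glued.
Proof.
move=> q p s; rewrite /glued => /andP[/eqP-> pq] /andP[/eqP<- qs].
rewrite eqxx /=; move: pq qs; case: (0 < q.1); rewrite ?orbT// !orbF.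
by move=> /eqP->.
Qed.

Canonical glued_equiv := EquivRel glued glued_refl glued_sym glued_trans.

Definition Yspace : topologicalType := quotient_topology {eq_quot glued}.

Definition Ypi : R * bool -> Yspace := \pi_(quotient_topology {eq_quot glued}).

Definition YU : set Yspace := Ypi @` [set p | p.2 = false].
Definition YV : set Yspace := Ypi @` [set p | p.2 = true].
Definition YW : set Yspace := YU `&` YV.

(* A homeomorphism from S onto R that carries W onto R_pos. *)
Definition adapted_chart (S : set Yspace) (phi : chart R Yspace) : Prop :=
  [/\ chart_dom phi = S, chart_cod phi = setT & phi @` YW = @Rpos R].

Definition adapted_atlas r (A : set (chart R Yspace))
    (phi psi : chart R Yspace) : Prop :=
  [/\ Cr_structures R Yspace r A, A phi, A psi,
      adapted_chart YU phi & adapted_chart YV psi].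

Definition transition_of r (phi psi : chart R Yspace) (g : posdiffeo R r) : Prop :=
  forall u : posR R, val (g u) = psi (chart_inv phi (val u)).

End GluedLines.

(* Main.v *)
(* Non-separation pins down the pair of origins of Y, so a homeomorphism of Y
   either preserves both sheets U and V or exchanges them. Read in adapted
   charts, a C^r-isomorphism therefore amounts to a pair of C^r-diffeomorphisms
   of R preserving R_pos that carries one transition map, or its inverse, to the
   other, which is the (W, +-)-double coset relation.

   Adapted charts exist because every C^r-structure on the line is standard.
   Put a smooth step function in a small chart around each point of the line,
   extended by constants; add up a locally finite family of them, normalised to
   vanish at 0. The sum H is C^r, strictly increasing and unbounded. Its
   derivative in a chart does not vanish, because the derivatives of two
   nondecreasing functions in the same chart never have opposite signs. So H is
   a global chart by the inverse function theorem.

   Conversely g in D is realised by gluing the identity chart of U to g extended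
   by the identity of the nonpositive half-line on V. Finally the double coset of
   the power map x^a, a > 1, determines a, since w(x) = O(x) at 0+ for w in W. *)
Require Import Defs.
From mathcomp Require Import all_boot all_order all_algebra.
From mathcomp Require Import all_classical all_reals all_analysis.
From mathcomp Require Import lra ring.

Set Implicit Arguments.
Unset Strict Implicit.
Unset Printing Implicit Defensive.

Import Order.TTheory GRing.Theory Num.Theory.
Import numFieldNormedType.Exports.

Local Open Scope ring_scope.
Local Open Scope classical_set_scope.

(** * Pointwise C^r regularity and the inverse function theorem *)

Section CnOn.
Context {R : realType}.
Implicit Types (A B : set R) (f g : R -> R) (n : nat) (r : diff_order).

(** Every composition of coordinate representations changes the domain on which it makes sense, so
    regularity is localised at a point ([Cr_at], [Cr_rep]) and the set-wise notions are recovered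
    only at the ends. The obstacle to a global chart is that charts of the line have no preferred
    orientation. A step is therefore made nondecreasing along the line, whichever way its chart
    runs: reversing a chart flips the sign of all derivatives read in it at once, so regularity
    survives addition. Differentiability, hence r different from 0, enters here and in the bound on
    w at 0. An adapted chart carries W onto R_pos and so increases along its sheet; reflections
    never occur. The remaining ambiguity is the exchange of the sheets, which turns a transition map
    into its inverse: this is the origin of the sign in the double cosets. For power maps the bound
    O(x) is applied to the extensions and to their inverses, which compares the exponents in both
    directions; taking a > 1 rules out the branch of the inverse, which would give a = 1/b. *)

Lemma Cr_on_sub r A B f : A `<=` B -> Cr_on r B f -> Cr_on r A f.
Proof.
move=> AB; suff Cn n : Cn_on n B f -> Cn_on n A f.
  by case: r => [n|Cf n] //=; [exact: Cn | exact: Cn].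
move=> [df cf]; split=> [i ltin x Ax|x /set_mem Ax]; first by apply: df => //; exact: AB.
by apply: cf; rewrite inE; exact: AB.
Qed.

Lemma Cn_on_inv n : Cn_on n [set x : R | x != 0] (fun x => x^-1).
Proof.
have oA : open [set x : R | x != 0] by exact: open_neq.
have dinv (x : R) : x != 0 -> is_derive x 1 (fun x : R => x^-1) (- (x^-1 * x^-1)).
  move=> x0; apply: is_derive_eq; first exact: (@is_deriveV _ id).
  by rewrite /= /GRing.scale/= mulr1 -exprVn expr2.
elim: n => [|n IHn].
  by split=> // x /set_mem x0; exact: inv_continuous.
apply/Cn_onS; split=> [x /dinv[]//|].
apply: (@eq_Cn_on _ n _ (cst (-1) * ((fun x => x^-1) * (fun x => x^-1))) _ oA).
  move=> x /set_mem /dinv[_ dx].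
  by rewrite derive1E dx [LHS]mulN1r.
exact: (Cn_on_mul oA (Cn_on_cst _ _ _) (Cn_on_mul oA IHn IHn)).
Qed.

(** Bootstrapping on g' = 1 / (f' o g): each order known for g gives the next one, as far as f'
    allows. *)
Lemma Cn_on_inverse n A B f g : open A -> open B ->
  set_fun A B f -> set_fun B A g -> {in A, cancel f g} -> {in B, cancel g f} ->
  Cn_on n.+1 A f -> (forall x, A x -> derive1 f x != 0) -> Cn_on n.+1 B g.
Proof.
move=> oA oB fAB gBA fK gK Cf f'0.
have /Cn_onS[df Cf'] := Cf.
have cf : {in A, continuous f} by exact: derivable_in_continuous.
have dg y : B y -> is_derive y 1 g (derive1 f (g y))^-1.
  move=> By; rewrite -{1}(gK y (mem_set By)).
  have nA : \forall x \near g y, A x by apply: open_nbhs_nbhs; split=> //; exact: gBA.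
  apply: is_derive_inverse.
  - by apply: filterS nA => x Ax; apply: fK; rewrite inE.
  - by apply: filterS nA => x Ax; apply: cf; rewrite inE.
  - by rewrite derive1E; apply/derivableP/df/gBA.
  - by apply: f'0; exact: gBA.
have step m : Cn_on m A (derive1 f) -> Cn_on m B g -> Cn_on m.+1 B g.
  move=> Cf'm Cg; apply/Cn_onS; split=> [y /dg[]//|].
  apply: (@eq_Cn_on _ m _ ((fun x => x^-1) \o (derive1 f \o g)) _ oB).
    by move=> y /set_mem /dg[_ dgy]; rewrite derive1E dgy.
  have oN : open [set x : R | x != 0] by exact: open_neq.
  apply: (Cn_on_comp oB oN _ (Cn_on_comp oB oA gBA Cg Cf'm) (@Cn_on_inv m)).
  by move=> y By; apply: f'0; exact: gBA.
have cg : Cn_on 0 B g.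
  split; [by [] | apply: derivable_in_continuous => y By].
  by case: (dg _ By).
elim: n Cf' {Cf} => [|n IHn] Cf'; first exact: (step _ Cf' cg).
exact: (step _ Cf' (IHn (Cn_onW Cf'))).
Qed.

Lemma Cr_on_C0 r A f : Cr_on r A f -> Cn_on 0 A f.
Proof.
by case: r => [n|Cf]; [elim: n => // n IHn /Cn_onW | exact: (Cf 0%N)].
Qed.

Lemma Cr_on_C1 r A f : r <> Some 0%N -> Cr_on r A f -> exists n, Cn_on n.+1 A f.
Proof. by case: r => [[//|n]|] _ Cf; [exists n | exists 0%N; exact: Cf]. Qed.

(** A whole neighbourhood, and for [None] the same one for all orders; this makes the notion stable
    under passing to nearby points, composition and local inversion. *)
Definition Cr_at r f x := exists Q, [/\ open Q, Q x & Cr_on r Q f].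

Lemma Cr_on_at r A f x : open A -> A x -> Cr_on r A f -> Cr_at r f x.
Proof. by move=> oA Ax Cf; exists A. Qed.

(** No patching is involved: [Cr_on] is a conjunction of conditions at the points of [A], whose
    derivatives are taken in R. *)
Lemma Cr_at_on r A f : (forall x, A x -> Cr_at r f x) -> Cr_on r A f.
Proof.
move=> Cf; suff Cn n : (forall x, A x -> exists Q, [/\ open Q, Q x & Cn_on n Q f]) -> Cn_on n A f.
  case: r Cf => [n|] Cf; first exact: Cn.
  by move=> n; apply: Cn => x /Cf[Q [oQ Qx CfQ]]; exists Q.
move=> {}Cf; split=> [i ltin x /Cf[Q [_ Qx [df _]]]|x /set_mem/Cf[Q [_ Qx [_ cf]]]].
  exact: df.
by apply: cf; rewrite inE.
Qed.

Lemma Cr_at_nbhs r f x : Cr_at r f x -> \forall y \near x, Cr_at r f y.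
Proof.
move=> [Q [oQ Qx Cf]]; have : nbhs x Q by exact: open_nbhs_nbhs.
by apply: filterS => y Qy; exists Q.
Qed.

Lemma Cr_at_continuous r f x : Cr_at r f x -> {for x, continuous f}.
Proof.
move=> [Q [_ Qx Cf]].
by have [_ cf] := Cr_on_C0 Cf; apply: cf; rewrite inE.
Qed.

Lemma Cr_at_derivable r f x : r <> Some 0%N -> Cr_at r f x -> derivable f x 1.
Proof.
move=> r0 [Q [_ Qx Cf]].
have [n Cn] := Cr_on_C1 r0 Cf.
by have /Cn_onS[df _] := Cn; exact: df.
Qed.

Lemma Cr_at_near r f g x : {near x, f =1 g} -> Cr_at r f x -> Cr_at r g x.
Proof.
move=> fg [Q [oQ Qx Cf]]; exists (Q `&` [set y | f y = g y]^°); split.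
- by apply: openI => //; exact: open_interior.
- by split=> //; exact: fg.
- apply: eq_Cr_on (Cr_on_sub _ Cf); first by apply: openI => //; exact: open_interior.
    by move=> y /set_mem[_ /interior_subset].
  by move=> y [].
Qed.

Lemma Cr_at_comp r f g x : Cr_at r f x -> Cr_at r g (f x) -> Cr_at r (g \o f) x.
Proof.
move=> Cf [P [oP Pfx Cg]]; have [Q [oQ Qx CfQ]] := Cf.
have cf : {in Q, continuous f}.
  by move=> y /set_mem Qy; apply: (@Cr_at_continuous r); exists Q.
have oQP : open (Q `&` f @^-1` P).
  rewrite openE => y [Qy Pfy]; apply: filterI; first exact: open_nbhs_nbhs.
  by apply: (cf y); [rewrite inE | exact: open_nbhs_nbhs].
exists (Q `&` f @^-1` P); split=> //.
by apply: (Cr_on_comp oQP oP) Cg => [y []//|]; apply: Cr_on_sub CfQ => y [].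
Qed.

Lemma Cr_at_id r x : Cr_at r id x.
Proof. by exists setT; split=> //; [exact: openT | exact: Cr_on_id]. Qed.

Lemma Cr_at_cst r c x : Cr_at r (fun=> c) x.
Proof.
exists setT; split=> //; first exact: openT.
by case: r => [n|n]; exact: Cn_on_cst.
Qed.

Lemma Cr_at_add r f g x : Cr_at r f x -> Cr_at r g x -> Cr_at r (f \+ g) x.
Proof.
move=> [Q [oQ Qx Cf]] [P [oP Px Cg]]; exists (Q `&` P); split=> //; first exact: openI.
have {}Cf : Cr_on r (Q `&` P) f by apply: Cr_on_sub Cf => y [].
have {}Cg : Cr_on r (Q `&` P) g by apply: Cr_on_sub Cg => y [].
have oOP := openI oQ oP.
by case: r Cf Cg => [n|] Cf Cg /=; [|move=> n]; apply: Cn_on_add.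
Qed.

Lemma Cr_at_mul r f g x : Cr_at r f x -> Cr_at r g x -> Cr_at r (f \* g) x.
Proof.
move=> [Q [oQ Qx Cf]] [P [oP Px Cg]]; exists (Q `&` P); split=> //; first exact: openI.
have {}Cf : Cr_on r (Q `&` P) f by apply: Cr_on_sub Cf => y [].
have {}Cg : Cr_on r (Q `&` P) g by apply: Cr_on_sub Cg => y [].
have oOP := openI oQ oP.
by case: r Cf Cg => [n|] Cf Cg /=; [|move=> n]; apply: Cn_on_mul.
Qed.

Lemma Cr_at_affine r (a b x : R) : Cr_at r (fun y => a * y + b) x.
Proof.
by apply: Cr_at_add (Cr_at_cst _ _ _); apply: Cr_at_mul (Cr_at_cst _ _ _) (Cr_at_id _ _).
Qed.

Lemma Cr_at_derive1_continuous r f x : r <> Some 0%N -> Cr_at r f x ->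
  {for x, continuous (derive1 f)}.
Proof.
move=> r0 [Q [oQ Qx Cf]].
have [n Cn] := Cr_on_C1 r0 Cf.
have /Cn_onS[_ Cf'] := Cn.
by apply: (@Cr_at_continuous (Some n)); exists Q.
Qed.

(** A left inverse near x suffices as hypothesis: in dimension one a continuous injection is locally
    open, which makes g continuous near f x and also a right inverse there. *)
Lemma Cr_at_inverse r f g x : r <> Some 0%N -> Cr_at r f x ->
  {near x, cancel f g} -> derive1 f x != 0 -> Cr_at r g (f x).
Proof.
move=> r0 Cf fK f'x0.
have cf : {near x, continuous f}.
  by apply: filterS (Cr_at_nbhs Cf) => y; exact: Cr_at_continuous.
have [cg gK] := near_can_continuousAcan_sym fK cf.
have gfx : g (f x) = x by exact: nbhs_singleton fK.
have [Q [oQ Qx CfQ]] := Cf.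
pose A := Q `&` [set y | g (f y) = y]^° `&` [set y | derive1 f y != 0]^°.
have oA : open A by apply: openI; [apply: openI => // |]; exact: open_interior.
have Ax : A x.
  split; first by split.
  have nz : nbhs (derive1 f x) [set z : R | z != 0].
    by apply: open_nbhs_nbhs; split=> //; exact: open_neq.
  exact: (Cr_at_derive1_continuous r0 Cf nz).
pose B := [set y | f (g y) = y]^° `&` (g @^-1` A)^°.
have oB : open B by apply: openI; exact: open_interior.
have Bfx : B (f x).
  split=> //; apply: (nbhs_singleton cg); rewrite gfx.
  exact: open_nbhs_nbhs.
have AK y : A y -> g (f y) = y by move=> [[_ /interior_subset]].
have BK y : B y -> f (g y) = y by move=> [/interior_subset].
have gBA y : B y -> A (g y) by move=> [_ /interior_subset].
(* [A] is cut down once more so that f and g are mutually inverse bijections between the open sets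
   [A'] and [B]. *)
pose A' := A `&` f @^-1` B.
have oA' : open A'.
  rewrite openE => y [Ay By]; apply: filterI; first exact: open_nbhs_nbhs.
  apply: (@Cr_at_continuous r); last exact: open_nbhs_nbhs.
  by exists Q; split=> //; case: Ay => [[]].
exists B; split=> //.
have CfA : Cr_on r A' f by apply: Cr_on_sub CfQ => y [[[]]].
suff Cn n : Cn_on n.+1 A' f -> Cn_on n.+1 B g.
  (* For [None] the order is raised by one before inverting, because the argument covers positive
     orders only. *)
  case: r r0 {Cf CfQ} CfA => [[|n]|] r0 CfA; first by case: r0.
    exact: (Cn n CfA).
  by move=> n; exact: (Cn_onW (Cn n (CfA n.+1))).
move=> CnA; apply: (Cn_on_inverse oA' oB _ _ _ _ CnA).
- by move=> y [].
- by move=> y By; split; [exact: gBA | rewrite /= BK].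
- by move=> y /set_mem[/AK].
- by move=> y /set_mem/BK.
- by move=> y [[_ /interior_subset]].
Qed.

End CnOn.

(** * A smooth step function *)

Lemma is_derive_affine {R : realType} (a b x : R) :
  is_derive x 1 (fun y => a * y + b) a.
Proof.
apply/is_derive1_caratheodory; exists (cst a); split=> [z||//]; last exact: cvg_cst.
by rewrite /=; ring.
Qed.

Section SmoothStep.
Context {R : realType}.

(* The family [x^-k exp(-1/x)] is closed under differentiation. *)
Definition flat (k : nat) (x : R) : R :=
  if 0 < x then x^-1 ^+ k * expR (- x^-1) else 0.

Lemma flat_le0 k x : x <= 0 -> flat k x = 0.
Proof. by rewrite /flat => x0; rewrite ltNge x0. Qed.

Lemma flat_gt0 k x : 0 < x -> 0 < flat k x.
Proof. by move=> x0; rewrite /flat x0 mulr_gt0 ?expR_gt0// exprn_gt0// invr_gt0. Qed.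

Lemma flat_ge0 k x : 0 <= flat k x.
Proof. by case: (ltP 0 x) => [/(flat_gt0 k)/ltW//|/(flat_le0 k)->]. Qed.

(** The exponential series gives exp t >= t^(k+1) / (k+1)! at t = 1/x. A bound linear in x for every
    k is enough for continuity at 0. *)
Lemma flat_bound k x : `|flat k x| <= k.+1`!%:R * `|x|.
Proof.
case: (ltP 0 x) => [x0|/(flat_le0 k)->]; last by rewrite normr0 mulr_ge0.
rewrite ger0_norm ?flat_ge0// gtr0_norm// /flat x0 expRN.
have t0 : 0 < x^-1 by rewrite invr_gt0.
have := expR_ge1Dxn k (ltW t0); move: (expR_gt0 x^-1).
set e := expR _ => e0 le_e.
rewrite ler_pdivrMr// [leRHS]mulrAC -ler_pdivrMr// [leLHS]mulrC -exprS.
have f0 : 0 < (k.+1)`!%:R :> R by rewrite ltr0n fact_gt0.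
rewrite [leRHS]mulrC -ler_pdivrMr//; lra.
Qed.

Lemma flat_continuous0 k : {for 0, continuous (flat k)}.
Proof.
rewrite /prop_for /continuous_at flat_le0//; apply: norm_cvg0.
apply: (@squeeze_cvgr _ _ _ _ (cst 0) (fun x : R => k.+1`!%:R * `|x|)).
- by near=> x; rewrite normr_ge0 flat_bound.
- exact: cvg_cst.
- rewrite -[X in _ --> X](mulr0 (k.+1`!%:R : R)); apply: cvgM; first exact: cvg_cst.
  rewrite -[X in _ --> X](normr0 R); exact: (@norm_continuous R R^o 0).
Unshelve. all: by end_near. Qed.

(** At 0 the difference quotient of [flat k] is exactly [flat k.+1], which is continuous with value
    0 there; elsewhere this is ordinary calculus. *)
Lemma is_derive_flat k (x : R) :
  is_derive x 1 (flat k) (- k%:R * flat k.+1 x + flat k.+2 x).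
Proof.
have [x0|x0|->] := ltgtP x 0; last first.
- apply/is_derive1_caratheodory; exists (flat k.+1); split.
  + move=> z; rewrite (@flat_le0 _ 0)// !subr0 /flat; case: ltP => [z0|]; last by rewrite mul0r.
    by rewrite exprS mulrAC (mulrAC z^-1) mulVf ?mul1r// gt_eqF.
  + exact: flat_continuous0.
  + by rewrite !flat_le0// mulr0 addr0.
- pose g (x : R) : R := x^-1 ^+ k * expR (- x^-1).
  have xn0 : x != 0 by rewrite gt_eqF.
  have dinv : is_derive x 1 (fun x : R => x^-1) (- (x^-1 * x^-1)).
    apply: is_derive_eq; first exact: (@is_deriveV _ id).
    by rewrite /= /GRing.scale/= mulr1 -exprVn expr2.
  have dg : is_derive x 1 g (- k%:R * flat k.+1 x + flat k.+2 x).
    have -> : g = ((fun y => y ^+ k * expR (- y)) \o (fun y : R => y^-1)) by [].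
    have dX (t : R) : is_derive t 1 (fun y : R => y ^+ k) (k%:R * t ^+ k.-1).
      split; first exact: exprn_derivable.
      by rewrite exp_derive /GRing.scale /= mulr1.
    have dE (t : R) : is_derive t 1 (expR \o -%R) (expR (- t) * -1).
      exact: is_derive1_comp.
    have dh := is_deriveM (dX x^-1) (dE x^-1).
    have := is_derive1_comp dh dinv.
    have -> : ((fun y : R => y ^+ k) * (expR \o -%R)) \o (fun y : R => y^-1) =
              (fun y => y ^+ k * expR (- y)) \o (fun y : R => y^-1) by [].
    move=> dgx; apply: is_derive_eq.
    rewrite /flat x0 /GRing.scale /=.
    case: k {g dX dh dgx} => [|k] /=; first by rewrite !expr0 !expr1 expr2; ring.
    rewrite !exprS -[k.+1%:R]natr1; ring.
  apply: (near_eq_is_derive _ dg).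
  by near=> y; rewrite /flat /g ifT//; near: y; exact: lt_nbhsr.
- have xn0 : x <= 0 by exact: ltW.
  rewrite !flat_le0// mulr0 addr0.
  apply: (@near_eq_is_derive _ _ _ (cst 0) (flat k)).
  + by near=> y; rewrite flat_le0//; near: y; apply: lt_le_nbhsl.
Unshelve. all: by end_near. Qed.

Lemma Cr_at_flat r k x : Cr_at r (flat k) x.
Proof.
suff Cn n : Cn_on n setT (flat k).
  by exists setT; split=> //; [exact: openT | case: r].
elim: n k => [|n IHn] k.
  split=> // y _; have [] := is_derive_flat k y; move=> /derivable1_diffP.
  by move=> /differentiable_continuous.
apply/Cn_onS; split=> [y _|]; first by case: (is_derive_flat k y).
have -> : derive1 (flat k) = (cst (- k%:R) * flat k.+1) + flat k.+2.
  by apply/funext => y; rewrite derive1E; case: (is_derive_flat k y).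
by apply: Cn_on_add openT _ (IHn _); exact: Cn_on_mul openT (Cn_on_cst _ _ _) (IHn _).
Qed.

Lemma flat0_lt x y : 0 <= x -> x < y -> flat 0 x < flat 0 y.
Proof.
rewrite le_eqVlt => /orP[/eqP<- y0|x0 xy]; first by rewrite flat_le0// flat_gt0.
have y0 := lt_trans x0 xy.
by rewrite /flat x0 y0 !mul1r ltr_expR ltrN2 ltf_pV2.
Qed.

Lemma flat0_le x y : x <= y -> flat 0 x <= flat 0 y.
Proof.
rewrite le_eqVlt => /orP[/eqP->//|xy].
by case: (leP 0 x) => [x0|/ltW/(flat_le0 0)->]; [exact/ltW/flat0_lt | exact: flat_ge0].
Qed.

(* Composing [exp(-1/x)] with its reflection, flat at 1, gives a step without any
   quotient: [S x = flat 0 (flat 0 1 - flat 0 (1 - x))]. *)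
Lemma smooth_step r : exists S : R -> R,
  [/\ forall x, Cr_at r S x, {homo S : x y / x <= y},
      forall x, x <= 0 -> S x = 0, forall x, 1 <= x -> S x = S 1 &
      (forall x y, 0 <= x -> x < y -> y <= 1 -> S x < S y) /\
      (forall x, 0 < x -> x < 1 -> derive1 S x != 0)].
Proof.
pose u (x : R) := flat 0 1 + -1 * flat 0 (-1 * x + 1).
have eu : u = (fun z => -1 * z + flat 0 1) \o (flat 0 \o (fun x => -1 * x + 1)).
  by apply/funext => x; rewrite /u /= addrC.
have ule x y : x <= y -> u x <= u y.
  by move=> xy; rewrite /u; have := @flat0_le (-1 * y + 1) (-1 * x + 1) ltac:(lra); lra.
have u0 : u 0 = 0 by rewrite /u mulr0 add0r; lra.
have u1 : u 1 = flat 0 1.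
  by rewrite /u (_ : -1 * 1 + 1 = 0 :> R); [rewrite (@flat_le0 _ 0)//; lra | lra].
exists (flat 0 \o u); split.
- move=> x; apply: Cr_at_comp; last exact: Cr_at_flat.
  rewrite eu; apply: Cr_at_comp; last exact: Cr_at_affine.
  by apply: Cr_at_comp; [exact: Cr_at_affine | exact: Cr_at_flat].
- by move=> x y xy /=; apply: flat0_le; exact: ule.
- by move=> x x0 /=; rewrite flat_le0// -u0 ule.
- by move=> x x1 /=; rewrite u1 /u (@flat_le0 _ (-1 * x + 1)) ?mulr0 ?addr0//; lra.
- split=> [x y x0 xy y1|x x0 x1] /=.
  have lt := @flat0_lt (-1 * y + 1) (-1 * x + 1) ltac:(lra) ltac:(lra).
  apply: flat0_lt; first by rewrite -u0 ule.
  by rewrite /u; lra.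
(* For k = 0 only one term of the derivative survives, and it is positive on R_pos. *)
have d0 (t : R) : is_derive t 1 (flat 0) (flat 2 t).
  by have := is_derive_flat 0 t; rewrite oppr0 mul0r add0r.
have du : is_derive x 1 u (flat 2 (-1 * x + 1)).
  have e : flat 2 (-1 * x + 1) = -1 * (flat 2 (-1 * x + 1) * -1) by ring.
  rewrite e eu.
  exact: is_derive1_comp (is_derive_affine _ _ _) (is_derive1_comp (d0 _) (is_derive_affine _ _ _)).
have ux : 0 < u x.
  by have := @flat0_lt (-1 * x + 1) 1; rewrite /u; move=> /(_ ltac:(lra) ltac:(lra)); lra.
have dS : is_derive x 1 (flat 0 \o u) (flat 2 (u x) * flat 2 (-1 * x + 1)).
  exact: is_derive1_comp (d0 _) du.
rewrite derive1E; case: dS => _ ->.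
by rewrite gt_eqF// mulr_gt0// flat_gt0//; lra.
Qed.

Lemma unit_smooth_step r : r <> Some 0%N -> exists S : R -> R,
  [/\ forall x, Cr_at r S x, {homo S : x y / x <= y},
      forall x, x <= 0 -> S x = 0, forall x, 1 <= x -> S x = 1 &
      (forall x y, 0 <= x -> x < y -> y <= 1 -> S x < S y) /\
      (forall x, 0 < x -> x < 1 -> derive1 S x != 0)].
Proof.
move=> r0; have [S [CS mS S0 S1 [sS dS]]] := smooth_step r.
have S1_gt0 : 0 < S 1 by rewrite -(S0 0 (lexx _)) sS.
exists (fun x => (S 1)^-1 * S x); split.
- by move=> x; apply: Cr_at_mul (Cr_at_cst _ _ _) (CS x).
- by move=> x y xy; rewrite ler_pM2l ?invr_gt0// mS.
- by move=> x /S0->; rewrite mulr0.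
- by move=> x /S1->; rewrite mulVf// gt_eqF.
- split=> [x y x0 xy y1|x x0 x1]; first by rewrite ltr_pM2l ?invr_gt0// sS.
  have -> : (fun x => (S 1)^-1 * S x) = (S 1)^-1 *: S by [].
  rewrite derive1E deriveZ; last exact: Cr_at_derivable r0 (CS x).
  by rewrite -derive1E mulf_neq0 ?dS// invr_eq0 gt_eqF.
Qed.

End SmoothStep.

(** * Charts and local representatives *)

Section ChartBasics.
Context {R : realType} {M : topologicalType}.
Implicit Types phi psi : chart R M.

Lemma chart_fun_cod phi m : chart_dom phi m -> chart_cod phi (phi m).
Proof. by case: (chart_homeo phi) => + _ _ _ _; apply. Qed.

Lemma chart_inv_dom phi y : chart_cod phi y -> chart_dom phi (chart_inv phi y).
Proof. by case: (chart_homeo phi) => _ + _ _ _; apply. Qed.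

Lemma chart_funK phi m : chart_dom phi m -> chart_inv phi (phi m) = m.
Proof. by move=> dm; case: (chart_homeo phi) => _ _ + _ _; apply; rewrite inE. Qed.

Lemma chart_invK phi y : chart_cod phi y -> phi (chart_inv phi y) = y.
Proof. by move=> dm; case: (chart_homeo phi) => _ _ _ + _; apply; rewrite inE. Qed.

Lemma chart_continuous phi m : chart_dom phi m -> {for m, continuous phi}.
Proof.
move=> dm; case: (chart_homeo phi) => _ _ _ _ [+ _].
rewrite (continuous_open_subspace _ (@chart_dom_open _ _ phi)); apply.
by rewrite inE.
Qed.

Lemma chart_inv_continuous phi y : chart_cod phi y -> {for y, continuous (chart_inv phi)}.
Proof.
move=> cy; case: (chart_homeo phi) => _ _ _ _ [_].
rewrite (continuous_open_subspace _ (@chart_cod_open _ _ phi)); apply.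
by rewrite inE.
Qed.

Lemma near_chart_dom phi m : chart_dom phi m -> \forall m' \near m, chart_dom phi m'.
Proof. by move=> dm; apply: open_nbhs_nbhs; split=> //; exact: chart_dom_open. Qed.

Lemma near_chart_cod phi y : chart_cod phi y -> \forall y' \near y, chart_cod phi y'.
Proof. by move=> dm; apply: open_nbhs_nbhs; split=> //; exact: chart_cod_open. Qed.

Lemma near_chart_inv phi m (P : set M) : chart_dom phi m ->
  (\forall m' \near m, P m') -> \forall y \near phi m, P (chart_inv phi y).
Proof.
move=> dm Pm; have cy := chart_fun_cod dm.
by apply: (chart_inv_continuous cy); rewrite chart_funK.
Qed.

Lemma chart_image_open phi (Q : set M) : open Q -> open (phi @` (chart_dom phi `&` Q)).
Proof.
move=> oQ; rewrite openE => _ [m [dm Qm] <-].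
have cy := chart_fun_cod dm.
have h : \forall y \near phi m, Q (chart_inv phi y).
  by apply: near_chart_inv => //; exact: open_nbhs_nbhs.
apply: filterS2 h (near_chart_cod cy) => y Qy cod_y.
exists (chart_inv phi y); last exact: chart_invK.
by split=> //; exact: chart_inv_dom.
Qed.

End ChartBasics.

Section LocalRep.
Context {R : realType}.

(** Fixing the point m lets representations be chained through any charts around m and its image,
    without tracking images of intersections of domains. *)
Definition Cr_rep r (M N : topologicalType) (phi : chart R M) (psi : chart R N)
  (h : M -> N) (m : M) := Cr_at r (psi \o h \o chart_inv phi) (phi m).

Lemma Cr_rep_comp r (M N P : topologicalType) (phi : chart R M) (psi : chart R N)
    (chi : chart R P) (h : M -> N) (k : N -> P) m :
  chart_dom phi m -> chart_dom psi (h m) -> {for m, continuous h} ->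
  Cr_rep r phi psi h m -> Cr_rep r psi chi k (h m) -> Cr_rep r phi chi (k \o h) m.
Proof.
move=> dm dhm ch Ch Ck.
have Ck' : Cr_at r (chi \o k \o chart_inv psi) ((psi \o h \o chart_inv phi) (phi m)).
  by rewrite /= chart_funK.
apply: Cr_at_near (Cr_at_comp Ch Ck').
have nh : \forall m' \near m, chart_dom psi (h m') by apply: ch; exact: near_chart_dom.
apply: filterS (near_chart_inv dm nh) => y dy /=.
by rewrite chart_funK.
Qed.

Lemma Cr_rep_id r (M : topologicalType) (phi : chart R M) m :
  chart_dom phi m -> Cr_rep r phi phi id m.
Proof.
move=> dm; apply: Cr_at_near (Cr_at_id r _).
by apply: filterS (near_chart_cod (chart_fun_cod dm)) => y cy /=; rewrite chart_invK.
Qed.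

Lemma Cr_compatibleP r (M : topologicalType) (phi psi : chart R M) :
  Cr_compatible r phi psi <->
  forall m, chart_dom phi m -> chart_dom psi m ->
    Cr_rep r phi psi id m /\ Cr_rep r psi phi id m.
Proof.
have oD : open (chart_dom phi `&` chart_dom psi).
  by apply: openI; exact: chart_dom_open.
have o1 : open (phi @` (chart_dom phi `&` chart_dom psi)).
  by apply: chart_image_open; exact: chart_dom_open.
have o2 : open (psi @` (chart_dom phi `&` chart_dom psi)).
  by rewrite setIC; apply: chart_image_open; exact: chart_dom_open.
split=> [[_ _ _ _ [C1 C2]] m d1 d2|C].
  by split; [apply: Cr_on_at o1 _ C1 | apply: Cr_on_at o2 _ C2]; exists m.
split.
- by move=> _ [m [d1 d2] <-]; exists m => //=; rewrite chart_funK.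
- by move=> _ [m [d1 d2] <-]; exists m => //=; rewrite chart_funK.
- by move=> _ /set_mem[m [d1 d2] <-] /=; rewrite !chart_funK.
- by move=> _ /set_mem[m [d1 d2] <-] /=; rewrite !chart_funK.
- by split; apply: Cr_at_on => _ [m [d1 d2] <-]; case: (C m d1 d2).
Qed.

Lemma Cr_mapP r (M : topologicalType) (A B : set (chart R M)) (h : M -> M) :
  continuous h ->
  Cr_map r A B h <->
  forall phi psi m, A phi -> B psi -> chart_dom phi m -> chart_dom psi (h m) ->
    Cr_rep r phi psi h m.
Proof.
move=> ch; split=> [C phi psi m Aphi Bpsi d1 d2|C phi psi Aphi Bpsi].
  apply: Cr_on_at (C _ _ Aphi Bpsi); last by exists m.
  apply: chart_image_open; apply: open_comp; last exact: chart_dom_open.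
  by move=> x _; exact: ch.
by apply: Cr_at_on => _ [m [d1 d2] <-]; exact: C.
Qed.

End LocalRep.

(** Meant for two nondecreasing functions of the line read in one chart: their increments have the
    same sign even if the chart reverses the line. A negative product of slopes at x would persist
    nearby and make a product of increments negative. *)
Lemma derive1_mul_ge0 {R : realType} (f g : R -> R) x :
  derivable f x 1 -> derivable g x 1 ->
  (forall y, 0 <= (f y - f x) * (g y - g x)) -> 0 <= derive1 f x * derive1 g x.
Proof.
move=> /derivableP/is_derive1_caratheodory[u [fu cu ux]].
move=> /derivableP/is_derive1_caratheodory[v [gv cv vx]] fg.
rewrite !derive1E -ux -vx leNgt; apply/negP => uv0.
have cuv : {for x, continuous (fun y => u y * v y)} by apply: cvgM.
have nz : nbhs (u x * v x) [set z : R | z < 0].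
  by apply: open_nbhs_nbhs; split=> //; exact: open_lt.
have [d /= d0 dP] := cuv _ nz.
have /= := dP (x + d / 2).
have h : ball x d (x + d / 2).
  by rewrite /ball /= opprD addrA subrr sub0r normrN gtr0_norm; lra.
move=> /(_ h); apply/negP; rewrite -leNgt.
have := fg (x + d / 2); rewrite fu gv.
have -> : x + d / 2 - x = d / 2 by ring.
rewrite mulrACA pmulr_lge0//; apply: mulr_gt0; lra.
Qed.

(** * Every C^r-structure on the line is standard *)

Section Clamp.
Context {R : realType}.
Implicit Types a b s : R.

(** Used to extend a function by constants beyond an interval without a case distinction in its
    definition. *)
Definition clamp a b s := Num.max a (Num.min s b).

Lemma clamp_itv a b s : a <= b -> a <= clamp a b s <= b.
Proof.
by move=> ab; rewrite /clamp le_max lexx ge_max ab ge_min lexx orbT.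
Qed.

Lemma clamp_le a b s s' : a <= b -> s <= s' -> clamp a b s <= clamp a b s'.
Proof.
move=> ab ss'; rewrite /clamp /Order.max /Order.min.
by case: (ltP s b) => ?; case: (ltP s' b) => ?; case: (ltP a s) => ?;
  case: (ltP a s') => ?; case: (ltP a b) => ?; lra.
Qed.

Lemma clamp_lt a b s s' : a < b -> s < b -> a < s' -> s < s' ->
  clamp a b s < clamp a b s'.
Proof.
move=> ab sb s'a ss'; rewrite /clamp /Order.max /Order.min.
by case: (ltP s b) => ?; case: (ltP s' b) => ?; case: (ltP a s) => ?;
  case: (ltP a s') => ?; case: (ltP a b) => ?; lra.
Qed.

End Clamp.

(** * Functions on an embedded line, read in charts *)

Section SmoothLine.
Context {R : realType} {M : topologicalType}.
Variables (r : diff_order) (A : set (chart R M)) (e : R -> M) (p : M -> R).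
Hypothesis r0 : r <> Some 0%N.
Hypothesis atlasA : is_Cr_atlas r A.
Hypothesis ce : continuous e.
Hypothesis cp : continuous p.
Hypothesis eK : cancel e p.
Hypothesis oe : open (range e).

Implicit Types theta : chart R M.

(* [e] is an open embedding of the line with continuous left inverse [p], so
   functions on the line are read in the charts of M through [p]. *)
Definition in_chart (theta : chart R M) (f : R -> R) := f \o p \o chart_inv theta.

Definition smooth_line (f : R -> R) := forall theta t, A theta ->
  chart_dom theta (e t) -> Cr_at r (in_chart theta f) (theta (e t)).

Lemma near_range t : \forall m \near e t, e (p m) = m.
Proof.
have : \forall m \near e t, range e m by apply: open_nbhs_nbhs; split=> //; exists t.
by apply: filterS => _ [s _ <-]; rewrite eK.
Qed.

Lemma near_in_chart theta t (P : set R) : chart_dom theta (e t) ->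
  (\forall s \near t, P s) -> \forall y \near theta (e t), P (p (chart_inv theta y)).
Proof.
move=> dt nP; apply: (near_chart_inv (P := fun m => P (p m))) => //.
by apply: cp; rewrite eK.
Qed.

Lemma in_chart_near theta f g t : chart_dom theta (e t) -> {near t, f =1 g} ->
  {near theta (e t), in_chart theta f =1 in_chart theta g}.
Proof. by move=> dt fg; exact: near_in_chart dt fg. Qed.

Lemma in_chart_eq theta f t s : chart_dom theta (e t) ->
  {near t, f =1 s \o theta \o e} -> {near theta (e t), in_chart theta f =1 s}.
Proof.
move=> dt fs; have h1 := near_in_chart dt fs.
have h2 := near_chart_inv dt (near_range t).
have h3 := near_chart_cod (chart_fun_cod dt).
near=> y; rewrite /in_chart /=.
have -> : f (p (chart_inv theta y)) = (s \o theta \o e) (p (chart_inv theta y)).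
  by near: y.
rewrite /= (_ : e (p (chart_inv theta y)) = chart_inv theta y); last by near: y.
by rewrite chart_invK//; near: y.
Unshelve. all: by end_near. Qed.

Lemma in_chart_change theta theta' f t :
  chart_dom theta (e t) -> chart_dom theta' (e t) ->
  {near theta' (e t),
    in_chart theta' f =1 in_chart theta f \o (theta \o chart_inv theta')}.
Proof.
move=> dt dt'; have := near_chart_inv dt' (near_chart_dom dt).
by apply: filterS => y dy; rewrite /in_chart /= chart_funK.
Qed.

Lemma smooth_at_change theta theta' f t : A theta -> A theta' ->
  chart_dom theta (e t) -> chart_dom theta' (e t) ->
  Cr_at r (in_chart theta f) (theta (e t)) ->
  Cr_at r (in_chart theta' f) (theta' (e t)).
Proof.
move=> At At' dt dt' Cf.
have [Ct _] := (Cr_compatibleP r theta' theta).1 (atlasA.2 _ _ At' At) _ dt' dt.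
have h := in_chart_change f dt dt'.
apply: (Cr_at_near (f := in_chart theta f \o (theta \o chart_inv theta'))).
  by apply: filterS h => y ->.
by apply: Cr_at_comp Ct _; rewrite /= chart_funK.
Qed.

Definition regular_at f t := exists theta,
  [/\ A theta, chart_dom theta (e t) & derive1 (in_chart theta f) (theta (e t)) != 0].

(** By the chain rule a derivative that vanishes in [theta] vanishes in every other chart, so the
    single witness in [regular_at] speaks for all charts. *)
Lemma regular_change f t theta : smooth_line f -> regular_at f t ->
  A theta -> chart_dom theta (e t) -> derive1 (in_chart theta f) (theta (e t)) != 0.
Proof.
move=> Cf [theta' [At' dt' D]] At dt; apply: contra_neq D => D0.
have h := in_chart_change f dt dt'.
have [Ct _] := (Cr_compatibleP r theta' theta).1 (atlasA.2 _ _ At' At) _ dt' dt.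
rewrite derive1E (near_eq_derive _ h) -derive1E derive1_comp.
- by rewrite /= chart_funK// D0 mul0r.
- exact: Cr_at_derivable r0 Ct.
- by rewrite /= chart_funK//; exact: Cr_at_derivable r0 (Cf _ _ At dt).
Qed.

Definition nondecr (f : R -> R) := {homo f : x y / x <= y}.

(** Strict growth seen from one point: it survives adding a nondecreasing function, so in a sum one
    term per point has to provide it. *)
Definition strict_at (f : R -> R) t := forall s, t < s -> f t < f s.


Lemma smooth_line_continuous f : smooth_line f -> continuous f.
Proof.
move=> Cf t; have [theta At dt] := atlasA.1 (e t).
have cF := Cr_at_continuous (Cf _ _ At dt).
have ct : {for t, continuous (theta \o e)}.
  by apply: continuous_comp; [exact: ce | exact: chart_continuous].
have cFt : {for t, continuous (in_chart theta f \o (theta \o e))}.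
  exact: continuous_comp ct cF.
have h : {near t, in_chart theta f \o (theta \o e) =1 f}.
  have nd : \forall s \near t, chart_dom theta (e s) by apply: ce; exact: near_chart_dom.
  by apply: filterS nd => s ds; rewrite /in_chart /= chart_funK// eK.
move: cFt; rewrite /prop_for /continuous_at (nbhs_singleton h) => cFt.
by apply: cvg_trans cFt; exact: near_eq_cvg.
Qed.

Lemma smooth_line_add f g : smooth_line f -> smooth_line g -> smooth_line (f \+ g).
Proof. by move=> Cf Cg theta t At dt; apply: Cr_at_add; [exact: Cf | exact: Cg]. Qed.

Lemma smooth_line_cst c : smooth_line (fun=> c).
Proof. by move=> theta t At dt; exact: Cr_at_cst. Qed.

Lemma smooth_line_scale a f : smooth_line f -> smooth_line (fun s => a * f s).
Proof.
by move=> Cf theta t At dt; apply: (Cr_at_mul (Cr_at_cst r a _)); exact: Cf.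
Qed.

Lemma smooth_line_local f : (forall t : R, exists g, smooth_line g /\ {near t, g =1 f}) ->
  smooth_line f.
Proof.
move=> H theta t At dt; have [g [Cg gf]] := H t.
exact: Cr_at_near (in_chart_near dt gf) (Cg _ _ At dt).
Qed.

Lemma regular_near f g (t : R) : {near t, f =1 g} -> regular_at f t -> regular_at g t.
Proof.
move=> fg [theta [At dt D]]; exists theta; split=> //.
by rewrite derive1E -(near_eq_derive _ (in_chart_near dt fg)) -derive1E.
Qed.

(** If the two derivatives cancelled, their product would be minus a square, whereas
    [derive1_mul_ge0] makes it nonnegative. *)
Lemma regular_add f g t : smooth_line f -> smooth_line g -> nondecr f -> nondecr g ->
  regular_at f t -> regular_at (f \+ g) t.
Proof.
move=> Cf Cg mf mg [theta [At dt D]]; exists theta; split=> //.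
have df := Cr_at_derivable r0 (Cf _ _ At dt).
have dg := Cr_at_derivable r0 (Cg _ _ At dt).
have DD : 0 <= derive1 (in_chart theta f) (theta (e t)) *
               derive1 (in_chart theta g) (theta (e t)).
  apply: derive1_mul_ge0 => // y; rewrite /in_chart /=.
  set s := p _; set s' := p _.
  have [ss'|/ltW s's] := leP s s'.
    by apply: mulr_le0; rewrite subr_le0; [exact: mf | exact: mg].
  by apply: mulr_ge0; rewrite subr_ge0; [exact: mf | exact: mg].
have -> : in_chart theta (f \+ g) = in_chart theta f + in_chart theta g by [].
rewrite derive1E (deriveD df dg) -!derive1E; apply: contraNneq D => D0.
rewrite -sqrf_eq0 eq_le sqr_ge0 andbT expr2.
move/eqP: D0; rewrite addrC addr_eq0 => /eqP D0; move: DD; rewrite D0.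
by rewrite mulrN oppr_ge0.
Qed.

Lemma regular_scale a f t : smooth_line f -> a != 0 -> regular_at f t ->
  regular_at (fun s => a * f s) t.
Proof.
move=> Cf a0 [theta [At dt D]]; exists theta; split=> //.
have -> : in_chart theta (fun s => a * f s) = a *: in_chart theta f by [].
rewrite derive1E deriveZ; last exact: Cr_at_derivable r0 (Cf _ _ At dt).
by rewrite -derive1E mulf_neq0.
Qed.

Lemma strict_add f g t : strict_at f t -> nondecr g -> strict_at (f \+ g) t.
Proof. by move=> sf mg s ts; apply: ltr_leD; [exact: sf | exact/mg/ltW]. Qed.

Lemma nondecr_add f g : nondecr f -> nondecr g -> nondecr (f \+ g).
Proof. by move=> mf mg x y xy; apply: lerD; [exact: mf | exact: mg]. Qed.

(** A continuous injection of an interval is monotone, and [eps] records its direction. The radius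
    [2 * d] leaves a margin around the interval of radius [d] on which a bump will rise. *)
Lemma monotone_chart t : exists theta (eps d : R),
  [/\ A theta, 0 < d, d <= 1 / 2, (eps = 1 \/ eps = -1) &
    (forall s, t - 2 * d <= s -> s <= t + 2 * d -> chart_dom theta (e s)) /\
    (forall s s', t - 2 * d <= s -> s < s' -> s' <= t + 2 * d ->
       eps * theta (e s) < eps * theta (e s'))].
Proof.
have [theta At dt] := atlasA.1 (e t).
have [d /= d0 dP] : nbhs t [set s | chart_dom theta (e s)].
  exact: ce (near_chart_dom dt).
(* With [d / 4] the closed interval of radius [2 * d'] stays inside the ball of radius [d]; with
   [1 / 2] the bump will be constant beyond distance 1 from t. *)
pose d' := Num.min (d / 4) (1 / 2).
have d'0 : 0 < d' by rewrite lt_min; apply/andP; split; lra.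
have d'd : d' <= d / 4 by rewrite ge_min lexx.
have d'1 : d' <= 1 / 2 by rewrite ge_min lexx orbT.
have dom s : t - 2 * d' <= s -> s <= t + 2 * d' -> chart_dom theta (e s).
  move=> s1 s2; apply: dP; rewrite /ball /=.
  by rewrite ltr_norml; apply/andP; split; lra.
have ct : {within `[t - 2 * d', t + 2 * d'], continuous (theta \o e)}.
  apply: continuous_in_subspaceT => s; rewrite inE /= in_itv /= => /andP[s1 s2].
  by apply: continuous_comp; [exact: ce | exact/chart_continuous/dom].
have it : {in `[t - 2 * d', t + 2 * d']%R &, injective (theta \o e)}.
  move=> s s'; rewrite !in_itv /= => /andP[s1 s2] /andP[s1' s2'] /(congr1 (chart_inv theta)).
  by rewrite !chart_funK; [move/(congr1 p); rewrite !eK | exact: dom | exact: dom].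
have [mt|mt] := itv_continuous_inj_mono ct it.
- exists theta, 1, d'; split=> //; first by left.
  split=> // s s' s1 ss' s2; rewrite !mul1r.
  by apply: mt => //; rewrite in_itv /=; apply/andP; split; lra.
- exists theta, (-1), d'; split=> //; first by right.
  split=> // s s' s1 ss' s2; rewrite !mulN1r ltrN2.
  by apply: mt => //; rewrite in_itv /=; apply/andP; split; lra.
Qed.

Lemma smooth_bump t : exists (f : R -> R) (d : R),
  [/\ 0 < d, d <= 1 / 2, smooth_line f, nondecr f &
   [/\ forall s, s <= t - 1 -> f s = 0, forall s, t + 1 <= s -> f s = 1 &
    forall s, t - d < s -> s < t + d -> strict_at f s /\ regular_at f s]].
Proof.
have [S [CS mS S0 S1 [sS dS]]] := @unit_smooth_step R r r0.
have [theta [eps [d [At d0 d1 heps [dom mono]]]]] := monotone_chart t.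
pose q s := eps * theta (e s).
pose w := q (t + d) - q (t - d).
have w0 : 0 < w by rewrite subr_gt0; apply: mono; lra.
(* The affine map sending the chart values at t - d and t + d to 0 and 1; [eps] undoes a decreasing
   chart. *)
pose L y := eps / w * y + - q (t - d) / w.
pose g s := L (theta (e s)).
have gE s : g s = (q s - q (t - d)) / w by rewrite /g /L /q; field; rewrite gt_eqF.
have g_lt s s' : t - 2 * d <= s -> s < s' -> s' <= t + 2 * d -> g s < g s'.
  move=> h1 h2 h3; rewrite !gE ltr_pM2r ?invr_gt0// ltrD2r; exact: mono.
have g_le s s' : t - 2 * d <= s -> s <= s' -> s' <= t + 2 * d -> g s <= g s'.
  by move=> h1; rewrite le_eqVlt => /orP[/eqP->//|h2] h3; exact/ltW/g_lt.
have gl : g (t - d) = 0 by rewrite gE subrr mul0r.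
have gr : g (t + d) = 1 by rewrite gE divff// gt_eqF.
have tdd : t - d < t + d by lra.
pose clip := clamp (t - d) (t + d).
have clipP s : t - d <= clip s <= t + d := clamp_itv s (ltW tdd).
have clip_le s s' : s <= s' -> clip s <= clip s' := @clamp_le _ _ _ s s' (ltW tdd).
have clip_lt s s' : s < t + d -> t - d < s' -> s < s' -> clip s < clip s' :=
  @clamp_lt _ _ _ s s' tdd.
(* Clamping before the chart is applied keeps the argument in the chart domain and makes f constant
   off [t - d, t + d]. *)
pose f s := S (g (clip s)).
have fl s : s <= t - d -> f s = 0.
  move=> sl; rewrite /f (_ : clip s = t - d) ?gl ?S0//.
  apply: max_idPl; rewrite ge_min sl//.
have fr s : t + d <= s -> f s = 1.
  move=> sr; rewrite /f (_ : clip s = t + d) ?gr ?S1//.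
  by rewrite /clip /clamp (min_idPr sr); apply: max_idPr; exact: ltW.
have fm s : t - 2 * d <= s -> s <= t + 2 * d -> f s = S (g s).
  move=> h1 h2; have [sl|sl] := leP s (t - d).
    by rewrite fl// S0// -gl g_le//; lra.
  have [sr|sr] := leP (t + d) s.
    by rewrite fr// S1// -gr g_le//; lra.
  rewrite /f (_ : clip s = s)//.
  by rewrite /clip /clamp (min_idPl (ltW sr)); apply: max_idPr; exact: ltW.
have near_mid s : t - 2 * d < s -> s < t + 2 * d ->
    {near s, f =1 (S \o L) \o theta \o e}.
  move=> h1 h2; near=> s'; rewrite fm//; apply: ltW.
    by near: s'; exact: lt_nbhsr.
  by near: s'; exact: lt_nbhsl.
have CSL y : Cr_at r (S \o L) y by apply: Cr_at_comp; [exact: Cr_at_affine | exact: CS].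
exists f, d; split=> //.
- move=> theta' s At' ds.
  have [sl|sl] := ltP s (t - d).
    apply: Cr_at_near (Cr_at_cst r 0 _); have : {near s, (fun=> 0) =1 f}.
      near=> s'; rewrite fl//; apply: ltW; near: s'; exact: lt_nbhsl.
    exact: in_chart_near.
  have [sr|sr] := ltP (t + d) s.
    apply: Cr_at_near (Cr_at_cst r 1 _); have : {near s, (fun=> 1) =1 f}.
      near=> s'; rewrite fr//; apply: ltW; near: s'; exact: lt_nbhsr.
    exact: in_chart_near.
  have dts : chart_dom theta (e s) by apply: dom; lra.
  apply: (smooth_at_change At At' dts ds).
  have [] := (near_mid s ltac:(lra) ltac:(lra), tt) => nm _.
  have h := in_chart_eq dts nm.
  by apply: Cr_at_near (CSL _); apply: filterS h => y ->.
- move=> s s' ss'; apply: mS; apply: g_le; [|exact: clip_le|].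
    by have := clipP s; lra.
  by have := clipP s'; lra.
split.
- by move=> s s1; apply: fl; lra.
- by move=> s s1; apply: fr; lra.
move=> s h1 h2; split.
  move=> s' ss'; have c1 := clipP s; have c2 := clipP s'.
  apply: sS.
  - by rewrite -gl; apply: g_le; lra.
  - by apply: g_lt; [lra | apply: clip_lt => //; lra | lra].
  - by rewrite -gr; apply: g_le; lra.
have ds : chart_dom theta (e s) by apply: dom; lra.
exists theta; split=> //.
have h := in_chart_eq ds (near_mid s ltac:(lra) ltac:(lra)).
rewrite derive1E (near_eq_derive _ h) -derive1E derive1_comp.
- rewrite mulf_neq0//.
    by apply: dS; [rewrite -gl | rewrite -gr]; apply: g_lt; lra.
  rewrite derive1E (@derive_val _ _ _ _ _ _ _ (is_derive_affine _ _ _)).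
  rewrite mulf_neq0 ?invr_eq0 ?(gt_eqF w0)//.
  by case: heps => ->; rewrite ?oppr_eq0 oner_eq0.
- exact: Cr_at_derivable r0 (Cr_at_affine _ _ _ _).
- exact: Cr_at_derivable r0 (CS _).
Unshelve. all: by end_near. Qed.

End SmoothLine.

(** * From bumps to a global coordinate *)

Section LineParametrization.
Context {R : realType} {M : topologicalType}.
Variables (r : diff_order) (A : set (chart R M)) (e : R -> M) (p : M -> R).
Hypothesis r0 : r <> Some 0%N.
Hypothesis atlasA : is_Cr_atlas r A.
Hypothesis ce : continuous e.
Hypothesis cp : continuous p.
Hypothesis eK : cancel e p.
Hypothesis oe : open (range e).

Local Notation smooth := (smooth_line r A e p).
Local Notation regular := (regular_at A e p).

(* Bumps centred in the n-th shell do not move on [-(n-1), n-1]; this makes the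
   sum over all shells locally finite. *)
Lemma shell (n : nat) : exists T : R -> R,
  [/\ smooth T, nondecr T, T 0 = 0, forall s, `|s| + 1 <= n%:R -> T s = 0 &
   [/\ forall s, n%:R <= `|s| -> `|s| <= n.+1%:R -> strict_at T s /\ regular T s,
       forall s, n.+2%:R <= s -> 1 <= T s & forall s, s <= - n.+2%:R -> T s <= -1]].
Proof.
have bumpP t : exists fd : (R -> R) * R, [/\ 0 < fd.2, smooth fd.1, nondecr fd.1 &
     [/\ forall s, s <= t - 1 -> fd.1 s = 0, forall s, t + 1 <= s -> fd.1 s = 1 &
    forall s, t - fd.2 < s -> s < t + fd.2 -> strict_at fd.1 s /\ regular fd.1 s]].
  by have [f [d [d0 _ sf mf fP]]] := smooth_bump r0 atlasA ce cp eK oe t; exists (f, d).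
have {bumpP}[F FP] := choice bumpP.
pose K := `[(n%:R : R), n.+1%:R] `|` `[- n.+1%:R, - n%:R].
have KP t : K t -> n%:R <= t \/ t <= - n%:R.
  by move=> [] /=; rewrite in_itv /= => /andP[h1 h2]; [left | right].
have sums (l : seq R) : (forall t, t \in l -> K t) -> exists T : R -> R,
  [/\ smooth T, nondecr T, T 0 = 0, forall s, `|s| + 1 <= n%:R -> T s = 0 &
   forall t s, t \in l -> t - (F t).2 < s -> s < t + (F t).2 ->
     strict_at T s /\ regular T s].
  elim: l => [_|t l IHl lK].
    by exists (fun=> 0); split=> //; exact: smooth_line_cst.
  have [s sl|T [sT mT T0 Tn TP]] := IHl.
    by apply: lK; rewrite inE sl orbT.
  have [d0 sf mf [fl fr fP]] := FP t.
  (* Each bump is normalised to vanish at 0 before it is added. *)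
  pose g : R -> R := (F t).1 \+ (fun=> - (F t).1 0).
  have mc : nondecr (fun=> - (F t).1 0) by [].
  have sc : smooth (fun=> - (F t).1 0) by exact: smooth_line_cst.
  have sg : smooth g by exact: smooth_line_add.
  have mg : nondecr g by exact: nondecr_add.
  exists (g \+ T); split.
  - exact: smooth_line_add.
  - exact: nondecr_add.
  - by rewrite /g /= T0 addr0 subrr.
  - move=> s sn; rewrite /= Tn// addr0 /g /=.
    have : `|s| <= n%:R - 1 by rewrite lerBrDr.
    rewrite ler_norml => /andP[s1 s2].
    have n1 : (1 : R) <= n%:R by apply: le_trans sn; rewrite lerDr.
    (* A bump centred at t >= n is 0 at both s and 0, one centred at t <= -n is 1 at both; either
       way the normalised bump vanishes at s. *)
    have [nt|nt] := KP t (lK t (mem_head _ _)).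
      by rewrite !fl ?subrr//; lra.
    by rewrite !fr ?subrr//; lra.
  - move=> t' s; rewrite inE => /orP[/eqP->|t'l] h1 h2.
      have [ss rs] := fP _ h1 h2.
      split; first by apply: strict_add => //; exact: strict_add.
      exact: (regular_add r0 sg sT mg mT (regular_add r0 sf sc mf mc rs)).
    have [ss rs] := TP _ _ t'l h1 h2.
    have -> : g \+ T = T \+ g by apply/funext => x /=; rewrite addrC.
    by split; [exact: strict_add | exact: (regular_add r0 sT sg mT mg rs)].
have cK : compact K by apply: compactU; exact: segment_compact.
rewrite compact_cover in cK.
have [||l lK Kl] := cK R K (fun t => `]t - (F t).2, t + (F t).2[).
- by move=> t _; exact: interval_open.
- move=> t Kt; exists t => //=; rewrite in_itv /=.
  by have [d0 _ _ _] := FP t; apply/andP; split; lra.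
have [t tl|T [sT mT T0 Tn TP]] := sums (finmap.enum_fset l).
  by have := lK t tl; rewrite inE.
have {}TP s : K s -> strict_at T s /\ regular T s.
  by move=> /Kl[t tl /=]; rewrite in_itv /= => /andP[h1 h2]; exact: TP h1 h2.
have nn : (n%:R : R) < n.+1%:R by rewrite ltr_nat.
have nn' : (n.+1%:R : R) < n.+2%:R by rewrite ltr_nat.
have n0 : (0 : R) <= n%:R by rewrite ler0n.
have Tpos : 0 < T n.+2%:R.
  rewrite -T0; apply: le_lt_trans (mT _ _ n0) _.
  have Kn : K n%:R by left; rewrite /= in_itv /= lexx ltW.
  by have [st _] := TP _ Kn; apply: st; lra.
have Tneg : T (- n.+2%:R) < 0.
  rewrite -T0; apply: le_lt_trans (_ : T (- n.+1%:R) < _).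
    by apply: mT; lra.
  have Kn : K (- n.+1%:R) by right; rewrite /= in_itv /= lexx lerN2 ltW.
  by have [st _] := TP _ Kn; apply: st; lra.
(* Each reciprocal normalises one end, and their sum does both: the scaled function reaches 1 at n +
   2 and -1 at -(n + 2). *)
pose a := (T n.+2%:R)^-1 + (- T (- n.+2%:R))^-1.
have i1 : 0 < (T n.+2%:R)^-1 by rewrite invr_gt0.
have i2 : 0 < (- T (- n.+2%:R))^-1 by rewrite invr_gt0 oppr_gt0.
have a0 : 0 < a by exact: addr_gt0.
exists (fun s => a * T s); split.
- exact: smooth_line_scale.
- by move=> x y xy; rewrite ler_pM2l// mT.
- by rewrite T0 mulr0.
- by move=> s sn; rewrite Tn// mulr0.
split.
- move=> s s1 s2; have [|st rs] := TP s.
    have [s0|s0] := leP 0 s.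
      by left; rewrite /= in_itv /=; move: s1 s2; rewrite ger0_norm// => -> ->.
    right; rewrite /= in_itv /=; move: s1 s2; rewrite ltr0_norm// => s1 s2.
    by rewrite lerNl s2 lerNr s1.
  split; last exact: (regular_scale r0 sT (lt0r_neq0 a0) rs).
  by move=> s' ss'; rewrite ltr_pM2l// st.
- move=> s s1; apply: (@le_trans _ _ (a * T n.+2%:R)); last by rewrite ler_pM2l// mT.
  by rewrite mulrDl mulVf ?gt_eqF// lerDl mulr_ge0// ltW.
- move=> s s1; apply: (@le_trans _ _ (a * T (- n.+2%:R))); first by rewrite ler_pM2l// mT.
  rewrite mulrDl -[X in _ + X]opprK -mulrN mulVf ?oppr_eq0 ?lt_eqF//.
  by rewrite gerDr mulr_ge0_le0// ltW.
Qed.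

Lemma smooth_homeo : exists H : R -> R,
  [/\ smooth H, {homo H : x y / x < y}, H 0 = 0, forall y, exists x, H x = y &
   forall t, regular H t].
Proof.
have [T TP] := choice shell.
pose P N (s : R) := \sum_(i < N) T i s.
have PS N : P N.+1 = P N \+ T N by apply/funext => s; rewrite /P big_ord_recr.
have P0 : P 0%N = fun=> 0 by apply/funext => s; rewrite /P big_ord0.
have sP N : smooth (P N).
  elim: N => [|N IHN]; first by rewrite P0; exact: smooth_line_cst.
  by rewrite PS; apply: smooth_line_add IHN _; case: (TP N).
have mP N : nondecr (P N).
  elim: N => [|N IHN]; first by rewrite P0.
  by rewrite PS; apply: nondecr_add IHN _; case: (TP N).
have PP N i s : (i < N)%N -> i%:R <= `|s| -> `|s| <= i.+1%:R ->
    strict_at (P N) s /\ regular (P N) s.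
  move=> + h1 h2; elim: N => // N IHN; rewrite ltnS leq_eqVlt => /orP[/eqP <-|/IHN[ss rs]].
    have [sT mT _ _ [TPi _ _]] := TP i; have [ss rs] := TPi _ h1 h2.
    have -> : P i.+1 = T i \+ P i by rewrite PS; apply/funext => x /=; rewrite addrC.
    split; first exact: strict_add.
    exact: (regular_add r0 sT (sP i) mT (mP i) rs).
  have [sT mT _ _ _] := TP N; rewrite PS.
  split; first exact: strict_add.
  exact: (regular_add r0 (sP N) sT (mP N) mT rs).
have PN0 N k s : `|s| + 1 <= N%:R -> P (N + k)%N s = P N s.
  move=> sN; elim: k => [|k IHk]; first by rewrite addn0.
  rewrite addnS PS /= IHk; have [_ _ _ Tz _] := TP (N + k)%N; rewrite Tz ?addr0//.
  by apply: le_trans sN _; rewrite ler_nat leq_addr.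
pose b (s : R) := (Num.trunc `|s|).
have bP s : (b s)%:R <= `|s| < (b s).+1%:R by apply: truncn_itv; exact: normr_ge0.
have bN s : `|s| + 1 < (b s).+2%:R.
  by have /andP[_ h] := bP s; rewrite -[in ltRHS]natr1 ltrD2r.
(* Since |s| < b s + 1, all shells from index b s + 2 on vanish at s. The inequality is strict, so
   near a point t one and the same partial sum computes [H]. *)
pose H s := P (b s).+2 s.
have HP N s : `|s| + 1 <= N%:R -> H s = P N s.
  move=> sN; rewrite /H; have [h|/ltnW h] := leqP N (b s).+2.
    by rewrite -(subnKC h) PN0.
  by rewrite -(subnKC h) PN0// ltW.
have nearH t : {near t, P (b t).+2 =1 H}.
  have h : \forall s \near t, `|s| < (b t).+1%:R.
    apply: cvgr_lt (@norm_continuous R R^o t) _ _.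
    by have /andP[] := bP t.
  by apply: filterS h => s h; rewrite (@HP (b t).+2)// -[leRHS]natr1 lerD2r ltW.
have Tge N s : 0 <= s -> 0 <= T N s.
  by have [_ mT T0 _ _] := TP N => s0; rewrite -T0 mT.
have Tle N s : s <= 0 -> T N s <= 0.
  by have [_ mT T0 _ _] := TP N => s0; rewrite -T0 mT.
exists H; split.
- by apply: (smooth_line_local cp eK) => t; exists (P (b t).+2).
- move=> s s' ss'; pose N := maxn (b s).+2 (b s').+2.
  have hs : `|s| + 1 <= N%:R.
    by apply: le_trans (ltW (bN s)) _; rewrite ler_nat leq_maxl.
  have hs' : `|s'| + 1 <= N%:R.
    by apply: le_trans (ltW (bN s')) _; rewrite ler_nat leq_maxr.
  rewrite (HP _ _ hs) (HP _ _ hs').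
  have /andP[h1 h2] := bP s.
  have [st _] := PP N (b s) s (leq_trans (leqnSn _) (leq_maxl _ _)) h1 (ltW h2).
  exact: st.
- by rewrite /H /P big1// => i _; case: (TP i).
- move=> y; pose N := (b y).+1.
  have /andP[_ yN] := bP y.
  have cH : continuous H.
    apply: (smooth_line_continuous atlasA ce eK).
    by apply: (smooth_line_local cp eK) => t; exists (P (b t).+2).
  (* Every shell of index k < N contributes at least 1 at N + 1 >= k + 2, and the two further shells
     are nonnegative there; N was chosen above |y|. The other end is symmetric. *)
  have Hge : N%:R <= H N.+1%:R.
    rewrite (HP N.+2) ?normr_nat ?natr1// (PS N.+1) /= (PS N) /=.
    have n0 : (0 : R) <= N.+1%:R by rewrite ler0n.
    rewrite -addrA; apply: (@le_trans _ _ (P N N.+1%:R)); last first.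
      by rewrite lerDl addr_ge0// Tge.
    have : forall k, (k <= N)%N -> k%:R <= P k N.+1%:R.
      elim=> [|k IHk] kN; first by rewrite P0.
      rewrite PS /= -natr1 lerD// ?IHk// 1?ltnW//.
      by have [_ _ _ _ [_ + _]] := TP k; apply; rewrite ler_nat.
    exact.
  have Hle : H (- N.+1%:R) <= - N%:R.
    rewrite (HP N.+2) ?normrN ?normr_nat ?natr1// (PS N.+1) /= (PS N) /=.
    have n0 : - N.+1%:R <= (0 : R) by rewrite oppr_le0 ler0n.
    rewrite -addrA; apply: (@le_trans _ _ (P N (- N.+1%:R))).
      by rewrite gerDl -oppr_ge0 opprD addr_ge0// oppr_ge0 Tle.
    have : forall k, (k <= N)%N -> P k (- N.+1%:R) <= - k%:R.
      elim=> [|k IHk] kN; first by rewrite P0 oppr0.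
      have -> : - k.+1%:R = - k%:R + -1 :> R by rewrite -natr1 opprD.
      rewrite PS /= lerD// ?IHk// 1?ltnW//.
      by have [_ _ _ _ [_ _ +]] := TP k; apply; rewrite lerN2 ler_nat.
    exact.
  have := yN; rewrite ltr_norml => /andP[y1 y2].
  have [|||c _ <-] := @IVT R H (- N.+1%:R) N.+1%:R y; last by exists c.
  - by apply: (@le_trans _ _ 0); rewrite ?oppr_le0 ler0n.
  - exact: continuous_subspaceT.
  - rewrite ge_min le_max (le_trans Hle (ltW y1)) (le_trans (ltW y2) Hge).
    by rewrite orbT.
- move=> t; apply: (regular_near cp eK (nearH t)).
  have /andP[h1 h2] := bP t.
  by have [] := PP (b t).+2 (b t) t (leqnSn _) h1 (ltW h2).
Qed.

Lemma line_parametrization : exists H G : R -> R,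
  [/\ cancel H G, cancel G H, continuous H /\ continuous G,
      {homo H : x y / x < y} /\ H 0 = 0 &
      forall theta t, A theta -> chart_dom theta (e t) ->
        Cr_at r (H \o p \o chart_inv theta) (theta (e t)) /\
        Cr_at r (theta \o e \o G) (H t)].
Proof.
have [H [sH mH H0 surj regH]] := smooth_homeo.
have cH := smooth_line_continuous atlasA ce eK sH.
have [G GK] := choice surj.
have HK : cancel H G.
  move=> x; have := GK (H x); have [/mH|/mH|//] := ltgtP (G (H x)) x => + h.
    by rewrite h ltxx.
  by rewrite h ltxx.
have cG : continuous G.
  move=> y; have nK : {near G y, cancel H G} by near=> z; exact: HK.
  have nc : {near G y, continuous H} by near=> z; exact: cH.
  by have := nbhs_singleton (near_can_continuous nK nc); rewrite GK.
exists H, G; split=> // theta t At dt; split; first exact: (sH _ _ At dt).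
have -> : H t = in_chart p theta H (theta (e t)) by rewrite /in_chart /= chart_funK// eK.
(* [theta \o e \o G] is a local inverse of [H] read in [theta], whose derivative is nonzero by
   regularity. *)
apply: Cr_at_inverse => //; first exact: (sH _ _ At dt).
- have h1 := near_chart_inv dt (near_range eK oe t).
  have h2 := near_chart_cod (chart_fun_cod dt).
  near=> y; rewrite /in_chart /= HK.
  rewrite (_ : e (p (chart_inv theta y)) = chart_inv theta y); last by near: y.
  by rewrite chart_invK//; near: y.
- exact: (regular_change r0 atlasA sH (regH t) At dt).
Unshelve. all: by end_near. Qed.

End LineParametrization.

(** * Topology of the two glued lines *)

Section GluedLinesTopology.
Local Open Scope quotient_scope.
Context {R : realType}.
Implicit Types (b c : bool) (x y : R) (m : Yspace R).

Definition sheet b x : Yspace R := Ypi (x, b).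
(** Glued points share their first coordinate, so the representative picked by [repr] does not
    matter. *)
Definition Yproj m : R := (repr m).1.

Lemma Ypi_eq (q q' : R * bool) : Ypi q = Ypi q' <-> glued q q'.
Proof. by split=> [/eqquotP//|h]; apply/eqquotP. Qed.

Lemma Yproj_pi (q : R * bool) : Yproj (Ypi q) = q.1.
Proof.
have : Ypi (repr (Ypi q)) = Ypi q by rewrite /Ypi reprK.
by move=> /Ypi_eq/andP[/eqP].
Qed.

Lemma sheetK b : cancel (sheet b) Yproj.
Proof. by move=> x; rewrite /sheet Yproj_pi. Qed.

Lemma sheet_eqP b c x y : sheet b x = sheet c y <-> x = y /\ (b = c \/ 0 < x).
Proof.
rewrite /sheet Ypi_eq /glued /=; split=> [/andP[/eqP-> /orP[/eqP->|]]|[-> h]].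
- by split=> //; left.
- by split=> //; right.
- by rewrite eqxx /=; case: h => [->|->]; rewrite ?eqxx ?orbT.
Qed.

Lemma sheet_glue b c x : 0 < x -> sheet b x = sheet c x.
Proof. by move=> x0; apply/sheet_eqP; split=> //; right. Qed.

Lemma sheetP m : exists b, m = sheet b (Yproj m).
Proof.
exists (repr m).2; rewrite /sheet /Yproj /Ypi -[LHS]reprK.
by case: (repr m).
Qed.

Lemma sheet_projK b m : range (sheet b) m -> sheet b (Yproj m) = m.
Proof. by move=> [x _ <-]; rewrite sheetK. Qed.

Lemma sheet_continuous b : continuous (sheet b).
Proof.
move=> x; have h : {for x, continuous (fun z : R => (z, b))}.
  move=> P [[A B] /= [nA nB] AB]; apply: filterS nA => z Az; apply: AB; split=> //=.
  exact: nbhs_singleton.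
by apply: (continuous_comp h); exact: pi_continuous.
Qed.

Lemma Yproj_continuous : continuous Yproj.
Proof.
apply/quotient_continuous.
rewrite (_ : _ \o _ = fst); last by apply/funext => q; exact: Yproj_pi.
by move=> q; exact: cvg_fst.
Qed.

Lemma sheet_open b (Q : set R) : open Q -> open (sheet b @` Q).
Proof.
move=> oQ; change (open (@Ypi R @^-1` (sheet b @` Q))).
rewrite openE => -[x c] [y Qy /sheet_eqP[yx bc]]; rewrite yx in Qy bc.
(* On its own copy the preimage of the image of [Q] is [Q]; on the other copy it is only the
   positive part of [Q]. *)
have [N [oN Nx NP]] : exists N : set R, [/\ open N, N x &
    forall z, N z -> sheet b z = sheet c z /\ Q z].
  case: bc => [<-|x0]; first by exists Q.
  exists (Q `&` @Rpos R); split=> //; first by apply: openI => //; exact: open_Rpos.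
  by move=> z [Qz z0]; split=> //; exact: sheet_glue.
exists (N, [set c]) => /=.
  by split; [exact: open_nbhs_nbhs | exact: discrete_set1].
move=> [z d] /= [Nz ->]; have [e Qz] := NP z Nz.
by exists z.
Qed.

Lemma sheet_range_open b : open (range (sheet b)).
Proof. by apply: sheet_open; exact: openT. Qed.

Lemma YUE : @YU R = range (sheet false).
Proof.
apply/seteqP; split=> [_ [[x b] /= -> <-]|_ [x _ <-]]; first by exists x.
by exists (x, false).
Qed.

Lemma YVE : @YV R = range (sheet true).
Proof.
apply/seteqP; split=> [_ [[x b] /= -> <-]|_ [x _ <-]]; first by exists x.
by exists (x, true).
Qed.

(** Indexing the sheets by [bool] treats both by one argument and turns an exchange of sheets into
    the shift [c (+) b]. *)
Definition YS b : set (Yspace R) := if b then @YV R else @YU R.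

Lemma YSE b : YS b = range (sheet b).
Proof. by case: b; rewrite /YS ?YUE ?YVE. Qed.

Lemma YW_sheet b x : YW (sheet b x) <-> 0 < x.
Proof.
rewrite /YW YUE YVE; split=> [[[y _ /esym/sheet_eqP[_ h]] [z _ /esym/sheet_eqP[_ h']]]|x0].
  by case: b h h' => [[]|_ []].
by split; exists x => //; exact: sheet_glue.
Qed.

Lemma YW_YS b : @YW R `<=` YS b.
Proof. by move=> m [mU mV]; case: b. Qed.

Lemma YWP m : YW m <-> forall b, YS b m.
Proof.
split=> [Wm b|h]; first exact: YW_YS.
by split; [exact: (h false) | exact: (h true)].
Qed.

Definition inseparable (M : topologicalType) (m m' : M) :=
  forall Q Q', open Q -> open Q' -> Q m -> Q' m' -> Q `&` Q' !=set0.

Lemma inseparable_origins b : inseparable (sheet b 0) (sheet (~~ b) 0).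
Proof.
move=> Q Q' oQ oQ' Qm Q'm.
have n1 : \forall x \near (0 : R), Q (sheet b x).
  by apply: (@sheet_continuous b); exact: open_nbhs_nbhs.
have n2 : \forall x \near (0 : R), Q' (sheet (~~ b) x).
  by apply: (@sheet_continuous (~~ b)); exact: open_nbhs_nbhs.
have [d /= d0 dP] : \forall x \near (0 : R), Q (sheet b x) /\ Q' (sheet (~~ b) x).
  by apply: filterS2 n1 n2.
have [h1 h2] : Q (sheet b (d / 2)) /\ Q' (sheet (~~ b) (d / 2)).
  by apply: dP; rewrite /ball_ /= sub0r normrN gtr0_norm; lra.
exists (sheet b (d / 2)); split=> //.
by rewrite (@sheet_glue b (~~ b))//; lra.
Qed.

(** Points with different coordinates are separated through [Yproj]. With the same coordinate x and
    on different sheets they coincide if x > 0, and the negative rays of the sheets separate them if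
    x < 0; only x = 0 remains. *)
Lemma inseparable_eq m m' : inseparable m m' -> m <> m' ->
  exists b, m = sheet b 0 /\ m' = sheet (~~ b) 0.
Proof.
move=> ins mm'; have [b mE] := sheetP m; have [c m'E] := sheetP m'.
have [xx'|xx'] := eqVneq (Yproj m) (Yproj m'); last first.
  have := @Rhausdorff R; rewrite open_hausdorff => /(_ _ _ xx')[[A B] /=].
  rewrite !inE => -[Ax By] [oA oB AB0].
  have oA' : open (Yproj @^-1` A).
    by apply: open_comp oA => z _; exact: Yproj_continuous.
  have oB' : open (Yproj @^-1` B).
    by apply: open_comp oB => z _; exact: Yproj_continuous.
  have [z [/= Az Bz]] := ins _ _ oA' oB' Ax By.
  by have : (A `&` B) (Yproj z) by []; rewrite AB0.
rewrite -xx' in m'E.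
have cb : c = ~~ b.
  by case: (eqVneq b c) => [bc|]; [case: mm'; rewrite mE m'E bc | case: (b); case: (c)].
subst c; set x := Yproj m in mE m'E.
have [x0|x0|x0] := ltgtP x 0.
- have oN : open [set z : R | z < 0] by exact: open_lt.
  have := ins _ _ (@sheet_open b _ oN) (@sheet_open (~~ b) _ oN).
  rewrite mE m'E => -[||_ [[y /= y0 <-] [z _ /sheet_eqP[zy]]]].
  + by exists x.
  + by exists x.
  + case=> [|z0]; first by case: (b).
    by move: y0 z0; rewrite zy => /lt_trans/[apply]; rewrite ltxx.
- by case: mm'; rewrite mE m'E; exact: sheet_glue.
- by exists b; rewrite mE m'E x0.
Qed.

Lemma connected_line : connected [set: R].
Proof. by apply/connected_intervalP => x y _ _ z _. Qed.

(** Connectedness of the line: the parameters sent into sheet [d] form an open set. The others land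
    on the open negative ray of the other sheet, since its origin is already the image of the other
    origin and h is injective; so the set is closed too. *)
Lemma homeo_sheet (h : Yspace R -> Yspace R) b d : continuous h -> injective h ->
  h (sheet b 0) = sheet d 0 -> h (sheet (~~ b) 0) = sheet (~~ d) 0 ->
  forall m, YS b m -> YS d (h m).
Proof.
move=> ch ih hb hb' m; rewrite !YSE => -[t _ <-].
pose T := [set t | range (sheet d) (h (sheet b t))].
have chs : continuous (h \o sheet b).
  by move=> x; apply: continuous_comp; [exact: sheet_continuous | exact: ch].
have TC : ~` T = (h \o sheet b) @^-1` (sheet (~~ d) @` [set x | x < 0]).
  apply/seteqP; split=> x; last first.
    move=> [z /= z0 hz] [y _ hy]; move: hz; rewrite -hy => /sheet_eqP[zy []].
      by case: (d).
    by move/(lt_trans z0); rewrite ltxx.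
  rewrite /T /=; have [c hx] := sheetP (h (sheet b x)); move: hx; set y := Yproj _ => hx nT.
  have cd : c = ~~ d.
    by move: nT; rewrite hx; case: (c); case: (d) => //= nT; case: nT; exists y.
  subst c; exists y => //=.
  rewrite ltNge le_eqVlt; apply/negP => /orP[/eqP y0|y0].
    move: hx; rewrite -y0 -hb' => /ih/sheet_eqP[-> [|]]; last by rewrite ltxx.
    by case: (b).
  by case: nT; rewrite hx (sheet_glue _ d y0); exists y.
suff TT : T = setT by have : T t by rewrite TT.
apply: connected_line.
- by exists 0, 0; rewrite ?hb.
- exists T; last by rewrite setTI.
  by apply: open_comp (@sheet_range_open d) => z _; exact: chs.
- exists T; last by rewrite setTI.
  rewrite -openC TC; apply: open_comp; first by move=> z _; exact: chs.
  by apply: sheet_open; exact: open_lt.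
Qed.

Lemma homeo_sheets (h k : Yspace R -> Yspace R) :
  continuous h -> continuous k -> cancel h k -> cancel k h ->
  exists c, forall b, (forall m, YS b m -> YS (c (+) b) (h m)) /\
                      (forall m, YS (c (+) b) m -> YS b (k m)).
Proof.
move=> ch ck hK kK.
have ins : inseparable (h (sheet false 0)) (h (sheet true 0)).
  move=> Q Q' oQ oQ' Qm Q'm.
  have oh P : open P -> open (h @^-1` P) by apply: open_comp => z _; exact: ch.
  have [z [Qz Q'z]] := @inseparable_origins false _ _ (oh _ oQ) (oh _ oQ') Qm Q'm.
  by exists (h z).
have nh : h (sheet false 0) <> h (sheet true 0).
  by move/(can_inj hK)/sheet_eqP => [_ []//]; rewrite ltxx.
have [c [h0 h1]] := inseparable_eq ins nh.
have hb b : h (sheet b 0) = sheet (c (+) b) 0.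
  by case: b; rewrite ?h0 ?h1 ?addbT ?addbF.
have hnb b : h (sheet (~~ b) 0) = sheet (~~ (c (+) b)) 0 by rewrite hb addbN.
exists c => b; split.
  exact: homeo_sheet ch (can_inj hK) (hb b) (hnb b).
apply: homeo_sheet ck (can_inj kK) _ _; first by rewrite -hb hK.
by rewrite -hnb hK.
Qed.

End GluedLinesTopology.

(** * Extendable diffeomorphisms and double cosets *)

Section PosDiffeos.
Context {R : realType} {r : diff_order}.
Implicit Types F G : R -> R.

(** A continuous injection is monotone, and a decreasing one would give F (-1) > F 1 > 0. *)
Lemma pos_increasing F : continuous F -> injective F ->
  (forall x, 0 < F x <-> 0 < x) -> {homo F : x y / x < y}.
Proof.
move=> cF iF pF.
have cF' : {within [set` (`]-oo, +oo[%R : interval R)], continuous F}.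
  exact: continuous_subspaceT.
have iF' : {in (`]-oo, +oo[%R : interval R) &, injective F} by move=> x y _ _; exact: iF.
have [mF x y xy|mF] := itv_continuous_inj_mono cF' iF'; first by apply: mF; rewrite ?in_itv.
have h : F 1 < F (-1) by apply: mF; rewrite ?in_itv//; lra.
have : 0 < F (-1) by apply: lt_trans h; apply/pF.
by move/pF; lra.
Qed.

Lemma posdiffeo_of F G : Cr_on r (@Rpos R) F -> Cr_on r (@Rpos R) G ->
  (forall x, 0 < x -> [/\ 0 < F x, 0 < G x, G (F x) = x & F (G x) = x]) ->
  (forall x y, 0 < x -> x < y -> F x < F y) ->
  exists g : posdiffeo R r, (forall u, val (g u) = F (val u)) /\
    (forall u, val (pd_inv g u) = G (val u)).
Proof.
move=> CF CG FG mF.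
have F0 (u : posR R) : 0 < F (val u) by have [] := FG _ (valP u).
have G0 (u : posR R) : 0 < G (val u) by have [] := FG _ (valP u).
pose f (u : posR R) : posR R := Sub (F (val u)) (F0 u).
pose f' (u : posR R) : posR R := Sub (G (val u)) (G0 u).
have fK : cancel f f' by move=> u; apply: val_inj; rewrite !SubK; have [] := FG _ (valP u).
have f'K : cancel f' f by move=> u; apply: val_inj; rewrite !SubK; have [] := FG _ (valP u).
have Cf : Cr_on r (@Rpos R) (ext_pos f).
  apply: eq_Cr_on open_Rpos _ CF => x /set_mem/Rpos_val[u ->].
  by rewrite ext_pos_val SubK.
have Cf' : Cr_on r (@Rpos R) (ext_pos f').
  apply: eq_Cr_on open_Rpos _ CG => x /set_mem/Rpos_val[u ->].
  by rewrite ext_pos_val SubK.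
have mf u v : val u < val v -> val (f u) < val (f v).
  by rewrite !SubK => uv; apply: mF => //; exact: valP.
by exists (PosDiffeo fK f'K Cf Cf' mf).
Qed.

Lemma extendable_of F G : (forall x, Cr_at r F x) -> (forall x, Cr_at r G x) ->
  cancel F G -> cancel G F -> (forall x, 0 < F x <-> 0 < x) ->
  exists2 w : posdiffeo R r, extendable w & forall u, F (val u) = val (w u).
Proof.
move=> CF CG FK GK pF.
have cF : continuous F by move=> x; exact: Cr_at_continuous (CF x).
have mF := pos_increasing cF (can_inj FK) pF.
have [||x x0|x y _|w [wF _]] := @posdiffeo_of F G.
- by apply: Cr_at_on => x _.
- by apply: Cr_at_on => x _.
- by split=> //; [exact/pF | apply/pF; rewrite GK].
- exact: mF.
exists w => //; exists F, G; split=> //.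
split; [by [] | by [] | by move=> x _ | by move=> x _ |].
by split; apply: Cr_at_on => x _.
Qed.

Lemma extendableE (w : posdiffeo R r) : extendable w -> exists F G : R -> R,
  [/\ forall x, Cr_at r F x, forall x, Cr_at r G x, cancel F G, cancel G F &
   (forall x, 0 < F x <-> 0 < x) /\ forall u, F (val u) = val (w u)].
Proof.
move=> [F [G [[_ _ FK GK [CF CG]] Fw]]].
have {}FK : cancel F G by move=> x; apply: FK; rewrite inE.
have {}GK : cancel G F by move=> x; apply: GK; rewrite inE.
exists F, G; split=> //.
- by move=> x; apply: Cr_on_at CF => //; exact: openT.
- by move=> x; apply: Cr_on_at CG => //; exact: openT.
(* [w] is onto R_pos and F is injective, so no point off R_pos can have a positive image. *)
split=> // x; split=> [Fx0|x0].
  have [u uE] := Rpos_val Fx0.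
  have : F (val (pd_inv w u)) = F x by rewrite Fw pd_invK uE.
  by move/(can_inj FK) => <-; exact: valP.
have [u ->] := Rpos_val x0; rewrite Fw; exact: valP.
Qed.

Lemma extendable1 : extendable (1%g : posdiffeo R r).
Proof.
exists id, id; split=> //; split=> //.
by split; exact: Cr_on_id.
Qed.

Lemma extendableV (w : posdiffeo R r) : extendable w -> extendable w^-1%g.
Proof.
move=> /extendableE[F [G [CF CG FK GK [pF Fw]]]].
exists G, F; split.
  split; [by [] | by [] | by move=> x _ | by move=> x _ |].
  by split; apply: Cr_at_on => x _.
by move=> u; rewrite -{1}(pd_invK w u) -Fw FK.
Qed.

Lemma extendableM (w w' : posdiffeo R r) :
  extendable w -> extendable w' -> extendable (w * w')%g.
Proof.
move=> /extendableE[F [G [CF CG FK GK [pF Fw]]]].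
move=> /extendableE[F' [G' [CF' CG' FK' GK' [pF' Fw']]]].
exists (F \o F'), (G' \o G); split; last by move=> u; rewrite /= Fw' Fw.
split; [by [] | by [] | | |].
- by move=> x _ /=; rewrite FK FK'.
- by move=> x _ /=; rewrite GK' GK.
by split; apply: Cr_at_on => x _; apply: Cr_at_comp.
Qed.

End PosDiffeos.

(** * Signed double cosets in an abstract group *)

Section DoubleCosets.
Context {G : groupType} {W : set G}.
Hypothesis W1 : W 1%g.
Hypothesis WM : forall x y, W x -> W y -> W (x * y)%g.
Hypothesis WV : forall x, W x -> W x^-1%g.
Local Open Scope group_scope.

(* [c] records whether the isomorphism exchanges the two sheets. *)
Definition pm_rel (g g' : G) (c : bool) := exists w0 w1, [/\ W w0, W w1 &
  (if c then g'^-1 else g') * w0 = w1 * g].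

(** The intertwining form is the one an isomorphism provides: [w0] and [w1] will be its readings on
    the two sheets. *)
Lemma pm_double_cosetP g g' : pm_double_coset W g g' <-> exists c, pm_rel g g' c.
Proof.
split=> [[] [w1 W1w [w2 W2w <-]]|[c [w0 [w1 [Ww0 Ww1]]]]].
- exists false, w2^-1, w1; split; [exact: WV | by [] |].
  by rewrite mulgK.
- exists true, w1, w2^-1; split; [by [] | exact: WV |].
  by rewrite !invgM invgK -!mulgA mulVg mulg1.
case: c => E.
  right; exists w0 => //; exists w1^-1; first exact: WV.
  by apply: invg_inj; rewrite !invgM !invgK mulgA -E -mulgA mulgV mulg1.
left; exists w1 => //; exists w0^-1; first exact: WV.
by rewrite -E mulgK.
Qed.

Lemma pm_double_coset_refl g : pm_double_coset W g g.
Proof. by left; exists 1 => //; exists 1 => //; rewrite mul1g mulg1. Qed.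

Lemma pm_double_coset_sub g g' : pm_double_coset W g g' ->
  pm_double_coset W g' `<=` pm_double_coset W g.
Proof.
move=> gg' x; case: gg' => -[w1 Ww1 [w2 Ww2 <-]] [] [v1 Wv1 [v2 Wv2 <-]].
- left; exists (v1 * w1); first exact: WM.
  by exists (w2 * v2); [exact: WM | rewrite !mulgA].
- right; exists (v1 * w2^-1); first exact/WM/WV.
  by exists (w1^-1 * v2); [exact/WM/Wv2/WV | rewrite !invgM !mulgA].
- right; exists (v1 * w1); first exact: WM.
  by exists (w2 * v2); [exact: WM | rewrite !mulgA].
- left; exists (v1 * w2^-1); first exact/WM/WV.
  by exists (w1^-1 * v2); [exact/WM/Wv2/WV | rewrite !invgM invgK !mulgA].
Qed.

Lemma pm_double_coset_sym g g' : pm_double_coset W g g' -> pm_double_coset W g' g.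
Proof.
case=> -[w1 Ww1 [w2 Ww2 <-]].
  left; exists w1^-1; first exact: WV.
  by exists w2^-1; [exact: WV | rewrite !mulgA mulVg mul1g mulgK].
right; exists w2; first by [].
exists w1; first by [].
by rewrite !invgM invgK !mulgA mulgV mul1g mulgVK.
Qed.

Lemma pm_double_coset_eq g g' :
  pm_double_coset W g = pm_double_coset W g' <-> pm_double_coset W g g'.
Proof.
split=> [->|gg']; first exact: pm_double_coset_refl.
by apply/seteqP; split; apply: pm_double_coset_sub; [exact: pm_double_coset_sym|].
Qed.

End DoubleCosets.

(** * Isomorphisms and transition maps *)

Section AdaptedChart.
Context {R : realType}.
Variables (b : bool) (phi : chart R (Yspace R)).
Hypothesis adphi : adapted_chart (YS b) phi.

Lemma adapted_dom m : chart_dom phi m <-> YS b m.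
Proof. by case: adphi => -> _ _. Qed.

Lemma adapted_invK : cancel (chart_inv phi) phi.
Proof. by move=> y; apply: chart_invK; case: adphi => _ -> _. Qed.

Lemma adapted_inv_YS y : YS b (chart_inv phi y).
Proof. by apply/adapted_dom/chart_inv_dom; case: adphi => _ -> _. Qed.

Lemma adapted_funK m : YS b m -> chart_inv phi (phi m) = m.
Proof. by move=> /adapted_dom; exact: chart_funK. Qed.

Lemma adapted_continuous m : YS b m -> {for m, continuous phi}.
Proof. by move=> /adapted_dom; exact: chart_continuous. Qed.

Lemma adapted_inv_continuous : continuous (chart_inv phi).
Proof. by move=> y; apply: chart_inv_continuous; case: adphi => _ -> _. Qed.

Lemma adapted_pos m : YS b m -> 0 < phi m <-> YW m.
Proof.
move=> Sm; have [_ _ posE] := adphi; split=> [pm|Wm].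
  have [m' Wm' mm'] : (phi @` @YW R) (phi m) by rewrite posE.
  by rewrite -(adapted_funK Sm) -mm' adapted_funK//; exact: YW_YS.
by have : @Rpos R (phi m) by rewrite -posE; exists m.
Qed.

Lemma adapted_inv_pos y : YW (chart_inv phi y) <-> 0 < y.
Proof.
by rewrite -(adapted_pos (adapted_inv_YS y)) adapted_invK.
Qed.

Lemma adapted_increasing : {homo phi \o sheet b : x y / x < y}.
Proof.
have S (x : R) : YS b (sheet b x) by rewrite YSE; exists x.
apply: pos_increasing => [x|x y /(congr1 (chart_inv phi))|x].
- by apply: continuous_comp; [exact: sheet_continuous | exact: adapted_continuous].
- by rewrite /= !adapted_funK// => /(congr1 Yproj); rewrite !sheetK.
- by rewrite /= (adapted_pos (S x)) YW_sheet.
Qed.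

End AdaptedChart.

(** Both charts increase along the common coordinate [Yproj]; this is why transition maps land in
    the orientation-preserving group. *)
Lemma transition_increasing {R : realType} b c (phi psi : chart R (Yspace R)) x y :
  adapted_chart (YS b) phi -> adapted_chart (YS c) psi -> 0 < x -> x < y ->
  psi (chart_inv phi x) < psi (chart_inv phi y).
Proof.
move=> adphi adpsi x0 xy; have y0 := lt_trans x0 xy.
have invE z : chart_inv phi z = sheet b (Yproj (chart_inv phi z)).
  by rewrite sheet_projK// -YSE; exact: adapted_inv_YS.
have pos z : 0 < z -> 0 < Yproj (chart_inv phi z).
  by move=> z0; apply/(YW_sheet b); rewrite -invE; apply/(adapted_inv_pos adphi).
rewrite (invE x) (invE y) !(sheet_glue b c) ?pos//.
apply: (adapted_increasing adpsi); rewrite ltNge le_eqVlt; apply/negP => /orP[/eqP e|].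
  by move: xy; rewrite -(adapted_invK adphi x) -(adapted_invK adphi y) invE (invE y) e ltxx.
move=> /(adapted_increasing adphi) /=; rewrite -!invE !(adapted_invK adphi) => /(lt_trans xy).
by rewrite ltxx.
Qed.

Lemma within_setT (S T : topologicalType) (f : S -> T) :
  {within setT, continuous f} -> continuous f.
Proof.
by rewrite (continuous_open_subspace _ openT) => cf x; apply: cf; rewrite inE.
Qed.

Section Classification.
Context {R : realType} {r : diff_order}.
Implicit Types (A B : set (chart R (Yspace R))) (phi psi : bool -> chart R (Yspace R)).

Definition adapted_charts A phi :=
  [/\ Cr_structures R (Yspace R) r A, forall b, A (phi b) &
      forall b, adapted_chart (YS b) (phi b)].

Lemma structure_rep A : Cr_structures R (Yspace R) r A -> forall
  (theta chi : chart R (Yspace R)) m,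
  A theta -> A chi -> chart_dom theta m -> chart_dom chi m -> Cr_rep r theta chi id m.
Proof.
move=> [[_ compA] _] theta chi m At Ac dt dc.
by have [] := (Cr_compatibleP r theta chi).1 (compA _ _ At Ac) m dt dc.
Qed.

Lemma transition_exists A phi : adapted_charts A phi ->
  exists g : posdiffeo R r, transition_of (phi false) (phi true) g.
Proof.
move=> [SA Aphi ad].
pose F b := phi (~~ b) \o chart_inv (phi b).
have WS b x : 0 < x -> YS (~~ b) (chart_inv (phi b) x).
  by move=> x0; apply: YW_YS; exact/(adapted_inv_pos (ad b)).
have CF b : Cr_on r (@Rpos R) (F b).
  apply: Cr_at_on => x x0; rewrite -(adapted_invK (ad b) x).
  apply: (structure_rep SA (Aphi b) (Aphi (~~ b))).
    by apply/(adapted_dom (ad b)); exact: adapted_inv_YS.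
  by apply/(adapted_dom (ad (~~ b))); exact: WS.
have F0 b x : 0 < x -> 0 < F b x.
  move=> x0; apply/(adapted_pos (ad (~~ b))); first exact: WS.
  exact/(adapted_inv_pos (ad b)).
have FK b x : 0 < x -> F (~~ b) (F b x) = x.
  move=> x0; rewrite /F /= (adapted_funK (ad (~~ b))); last exact: WS.
  by rewrite negbK (adapted_invK (ad b)).
have [||x x0|x y|g [gE _]] := @posdiffeo_of R r (F false) (F true).
- exact: CF.
- exact: CF.
- by split; [exact: F0 | exact: F0 | exact: (FK false) | exact: (FK true)].
- exact: (transition_increasing (ad false) (ad true)).
by exists g => u; rewrite gE.
Qed.

(* For [g] the transition map from [phi false] to [phi true], [pd_pow g c] is the
   one from [phi c] to [phi (~~ c)]. *)
Definition pd_pow (g : posdiffeo R r) (c : bool) : posdiffeo R r :=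
  if c then (g^-1)%g else g.

Lemma transition_pow A phi g c u : adapted_charts A phi ->
  transition_of (phi false) (phi true) g ->
  chart_inv (phi (~~ c)) (val (pd_pow g c u)) = chart_inv (phi c) (val u).
Proof.
move=> [_ _ ad] tg.
have tgE v : chart_inv (phi true) (val (g v)) = chart_inv (phi false) (val v).
  rewrite tg (adapted_funK (ad true))//; apply: YW_YS.
  by apply/(adapted_inv_pos (ad false)); exact: valP.
case: c => /=; last exact: tgE.
have gV : g ((g^-1)%g u) = u by exact: pd_invK.
by have := tgE ((g^-1)%g u); rewrite gV => ->.
Qed.

Lemma YW_homeo (h k : Yspace R -> Yspace R) c : cancel h k ->
  (forall b, (forall m, YS b m -> YS (c (+) b) (h m)) /\
             (forall m, YS (c (+) b) m -> YS b (k m))) ->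
  forall m, YW (h m) <-> YW m.
Proof.
move=> hK hk m; split=> /YWP Wm; apply/YWP => b.
  by rewrite -(hK m); apply: (hk b).2.
by have := (hk (c (+) b)).1 m (Wm _); rewrite addbA addbb addFb.
Qed.

Lemma isomorphic_coset A B phi psi gA gB :
  adapted_charts A phi -> adapted_charts B psi ->
  transition_of (phi false) (phi true) gA -> transition_of (psi false) (psi true) gB ->
  Cr_isomorphic r A B -> exists c, pm_rel (W := @extendable R r) gA gB c.
Proof.
move=> adA adB tA tB [h [k [[_ _ hK kK [ch ck]] Ch Ck]]].
have [SA Aphi ad] := adA; have [SB Bpsi ad'] := adB.
have {}hK : cancel h k by move=> m; apply: hK; rewrite inE.
have {}kK : cancel k h by move=> m; apply: kK; rewrite inE.
have {}ch : continuous h by exact: within_setT.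
have {}ck : continuous k by exact: within_setT.
have {}Ch := (Cr_mapP r A B ch).1 Ch; have {}Ck := (Cr_mapP r B A ck).1 Ck.
have [c hk] := homeo_sheets ch ck hK kK.
have hW := YW_homeo hK hk.
(* On sheet [b] the map h, read in adapted charts, is a diffeomorphism of the whole line, so its
   restriction to R_pos is extendable. *)
have lift b : exists2 w : posdiffeo R r, extendable w & forall u,
    chart_inv (psi (c (+) b)) (val (w u)) = h (chart_inv (phi b) (val u)).
  have hS y : YS (c (+) b) (h (chart_inv (phi b) y)).
    by apply: (hk b).1; exact: adapted_inv_YS.
  have kS y : YS b (k (chart_inv (psi (c (+) b)) y)).
    by apply: (hk b).2; exact: adapted_inv_YS.
  have [||x|x|x|w Ww wE] := @extendable_of R r
    (psi (c (+) b) \o h \o chart_inv (phi b)) (phi b \o k \o chart_inv (psi (c (+) b))).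
  - move=> x; have := Ch (phi b) (psi (c (+) b)) (chart_inv (phi b) x) (Aphi b) (Bpsi _).
    rewrite /Cr_rep (adapted_invK (ad b)); apply.
      by apply/(adapted_dom (ad b)); exact: adapted_inv_YS.
    exact/(adapted_dom (ad' _)).
  - move=> x; have := Ck (psi (c (+) b)) (phi b) (chart_inv (psi (c (+) b)) x) (Bpsi _) (Aphi b).
    rewrite /Cr_rep (adapted_invK (ad' _)); apply.
      by apply/(adapted_dom (ad' _)); exact: adapted_inv_YS.
    exact/(adapted_dom (ad _)).
  - by rewrite /= (adapted_funK (ad' _) (hS x)) hK (adapted_invK (ad b)).
  - by rewrite /= (adapted_funK (ad _) (kS x)) kK (adapted_invK (ad' _)).
  - by rewrite /= (adapted_pos (ad' _) (hS x)) hW (adapted_inv_pos (ad b)).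
  exists w => // u; rewrite -wE /= (adapted_funK (ad' _))//.
have [w0 Ww0 w0E] := lift false; have [w1 Ww1 w1E] := lift true.
exists c, w0, w1; split=> //.
change (pd_pow gB c * w0 = w1 * gA)%g.
apply: posdiffeo_eq => u; apply: val_inj.
change (val (pd_pow gB c (w0 u)) = val (w1 (gA u))).
(* Through the injective inverse chart both sides become the image under h of one point of W,
   reached once from each sheet. *)
apply: (can_inj (adapted_invK (ad' (~~ c)))).
rewrite (transition_pow c _ adB tB) -{1}[c]addbF w0E -addbT w1E.
by rewrite -(transition_pow false u adA tA).
Qed.

End Classification.

Lemma glue_sheets {R : realType} (T : Type) (H : bool -> Yspace R -> T) :
  (forall m, YW m -> H false m = H true m) ->
  exists h, forall b m, YS b m -> h m = H b m.
Proof.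
move=> HW; exists (fun m => if `[< YS false m >] then H false m else H true m).
move=> b m Sm; case: asboolP => [Sf|nSf]; case: b Sm => Sm //.
by apply: HW; split.
Qed.

(** * From double cosets back to isomorphisms *)

Section Converse.
Context {R : realType} {r : diff_order}.
Implicit Types (A B : set (chart R (Yspace R))) (phi psi : bool -> chart R (Yspace R)).

Lemma YS_cover (m : Yspace R) : exists b, YS b m.
Proof. by have [b mE] := sheetP m; exists b; rewrite YSE mE; exists (Yproj m). Qed.

Lemma YS_open b : open (@YS R b).
Proof. by rewrite YSE; exact: sheet_range_open. Qed.

Lemma sheetwise_continuous (h : Yspace R -> Yspace R) (H : bool -> Yspace R -> Yspace R) :
  (forall b m, YS b m -> h m = H b m) ->
  (forall b m, YS b m -> {for m, continuous (H b)}) -> continuous h.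
Proof.
move=> hH cH m; have [b Sm] := YS_cover m.
have nS : \forall m' \near m, YS b m' by apply: open_nbhs_nbhs; split=> //; exact: YS_open.
rewrite /continuous_at (hH b m Sm); apply: cvg_trans (cH b m Sm).
have e : {near m, H b =1 h} by apply: filterS nS => m' Sm'; rewrite (hH b).
exact: (@near_eq_cvg _ _ (nbhs m) _ _ _ e).
Qed.

(** In adapted charts h is [F b]; arbitrary charts of [A] and [B] are reached by composing with the
    transition maps inside each structure. *)
Lemma sheetwise_Cr_map A B phi psi c (F : bool -> R -> R) (h : Yspace R -> Yspace R) :
  adapted_charts (r := r) A phi -> adapted_charts (r := r) B psi ->
  (forall b x, Cr_at r (F b) x) ->
  (forall b m, YS b m -> h m = chart_inv (psi (c (+) b)) (F b (phi b m))) ->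
  continuous h /\ Cr_map r A B h.
Proof.
move=> [SA Aphi ad] [SB Bpsi ad'] CF hE.
have ch : continuous h.
  apply: sheetwise_continuous hE _ => b m Sm.
  apply: (@continuous_comp _ _ _ (F b \o phi b)); last exact: (adapted_inv_continuous (ad' _)).
  apply: continuous_comp; first exact: (adapted_continuous (ad b)).
  exact: Cr_at_continuous (CF b _).
split=> //; apply/Cr_mapP => // theta chi m At Bc dt dc.
have [b Sm] := YS_cover m.
have dm : chart_dom (phi b) m by apply/(adapted_dom (ad b)).
have dhm : chart_dom (psi (c (+) b)) (h m).
  by apply/(adapted_dom (ad' _)); rewrite (hE b)//; exact: (adapted_inv_YS (ad' _)).
have chm : {for m, continuous h} := ch m.
have cid : {for m, continuous (@id (Yspace R))} by exact: cvg_id.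
have C3 := structure_rep SB (Bpsi (c (+) b)) Bc dhm dc.
suff C : Cr_rep r theta (psi (c (+) b)) h m.
  exact: (Cr_rep_comp (k := id) dt dhm chm C C3).
have C1 := structure_rep SA At (Aphi b) dt dm.
suff C2 : Cr_rep r (phi b) (psi (c (+) b)) h m.
  exact: (Cr_rep_comp (h := id) dt dm cid C1 C2).
have CFm := CF b (phi b m); apply: Cr_at_near CFm; near=> y => /=.
by rewrite (hE b) ?(adapted_invK (ad b)) ?(adapted_invK (ad' _))//; exact: (adapted_inv_YS (ad b)).
Unshelve. all: by end_near. Qed.

Lemma coset_isomorphic A B phi psi gA gB c :
  adapted_charts (r := r) A phi -> adapted_charts (r := r) B psi ->
  transition_of (phi false) (phi true) gA -> transition_of (psi false) (psi true) gB ->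
  pm_rel (W := @extendable R r) gA gB c -> Cr_isomorphic r A B.
Proof.
move=> adA adB tA tB [w0 [w1 [Ww0 Ww1 E]]].
have [SA Aphi ad] := adA; have [SB Bpsi ad'] := adB.
have {}E u : pd_pow gB c (w0 u) = w1 (gA u) by exact: (congr1 (fun g : posdiffeo R r => g u) E).
pose w b := if b then w1 else w0.
have /choice[FG FGP] : forall b, exists FG : (R -> R) * (R -> R),
   [/\ forall x, Cr_at r FG.1 x, forall x, Cr_at r FG.2 x, cancel FG.1 FG.2, cancel FG.2 FG.1 &
   (forall x, 0 < FG.1 x <-> 0 < x) /\ forall u, FG.1 (val u) = val (w b u)].
  move=> b; have Ww : extendable (w b) by case: b.
  by have [F [G FGP]] := extendableE Ww; exists (F, G).
pose F b := (FG b).1; pose G b := (FG b).2.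
pose H b m := chart_inv (psi (c (+) b)) (F b (phi b m)).
(* Sheet d of the target comes from sheet [c (+) d] of the source. *)
pose K d m := chart_inv (phi (c (+) d)) (G (c (+) d) (psi d m)).
have FK b x : G b (F b x) = x by rewrite /F /G; case: (FGP b).
have GK b x : F b (G b x) = x by rewrite /F /G; case: (FGP b).
have CF b x : Cr_at r (F b) x by rewrite /F; case: (FGP b).
have CG b x : Cr_at r (G b) x by rewrite /G; case: (FGP b).
have pF b x : 0 < F b x <-> 0 < x by rewrite /F; case: (FGP b) => _ _ _ _ [].
have Fw b u : F b (val u) = val (w b u) by rewrite /F; case: (FGP b) => _ _ _ _ [].
(* The double coset equation is precisely the agreement of the two sheet maps on W. *)
have HW m : YW m -> H false m = H true m.
  move=> Wm; have [u uE] := Rpos_val ((adapted_pos (ad false) (YW_YS false Wm)).2 Wm).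
  have mE : m = chart_inv (phi false) (val u).
    by rewrite -uE (adapted_funK (ad _))//; exact: YW_YS.
  have mE' : m = chart_inv (phi true) (val (gA u)).
    by rewrite (transition_pow false u adA tA).
  rewrite /H {1}mE mE' !(adapted_invK (ad _)) !Fw /= -E addbF addbT.
  by rewrite (transition_pow c _ adB tB).
have [h hE] := glue_sheets HW.
have hS b m : YS b m -> YS (c (+) b) (h m).
  by move=> Sm; rewrite (hE b)//; exact: (adapted_inv_YS (ad' _)).
have Kh b m : YS b m -> K (c (+) b) (h m) = m.
  move=> Sm; rewrite (hE b)// /K /H (adapted_invK (ad' _)) addbA addbb addFb FK.
  by rewrite (adapted_funK (ad b)).
(* Serves to glue the inverse: each point of W is h m' with m' in W, where both candidates for the
   inverse return m'. *)
have hsurj m : YW m -> exists2 m', YW m' & h m' = m.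
  move=> Wm; pose v := psi c m.
  have v0 : 0 < v by apply/(adapted_pos (ad' c)) => //; exact: YW_YS.
  have u0 : 0 < G false v by apply/(pF false); rewrite GK.
  exists (chart_inv (phi false) (G false v)); first exact/(adapted_inv_pos (ad false)).
  rewrite (hE false); last exact: (adapted_inv_YS (ad _)).
  rewrite /H (adapted_invK (ad _)) GK addbF (adapted_funK (ad' _))//.
  exact: YW_YS.
have KW m : YW m -> K false m = K true m.
  move=> /hsurj[m' Wm' <-].
  have K' d : K d (h m') = m'.
    by have := Kh (c (+) d) m' (YW_YS _ Wm'); rewrite addbA addbb addFb.
  by rewrite !K'.
have [k kE] := glue_sheets KW.
have [ch Ch] := sheetwise_Cr_map adA adB CF hE.
have [ck Ck] := sheetwise_Cr_map adB adA (fun d => CG (c (+) d)) kE.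
have hK : cancel h k.
  by move=> m; have [b Sm] := YS_cover m; rewrite (kE (c (+) b)) ?Kh//; exact: hS.
have kK : cancel k h.
  move=> m; have [d Sm] := YS_cover m.
  rewrite (hE (c (+) d)); last by rewrite (kE d)//; exact: (adapted_inv_YS (ad _)).
  rewrite (kE d)// /H /K (adapted_invK (ad _)) GK addbA addbb addFb.
  exact: (adapted_funK (ad' d)).
exists h, k; split=> //; split; [by [] | by [] | by move=> m _ | by move=> m _ |].
by split; exact: continuous_subspaceT.
Qed.

Lemma isomorphic_cosetP A B phi psi gA gB :
  adapted_charts (r := r) A phi -> adapted_charts (r := r) B psi ->
  transition_of (phi false) (phi true) gA -> transition_of (psi false) (psi true) gB ->
  Cr_isomorphic r A B <->
  pm_double_coset (@extendable R r) gA = pm_double_coset (@extendable R r) gB.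
Proof.
move=> adA adB tA tB.
have W1 := @extendable1 R r.
have WM := @extendableM R r; have WV := @extendableV R r.
rewrite (pm_double_coset_eq W1 WM WV) (pm_double_cosetP WV).
split=> [|[c]]; first exact: (isomorphic_coset adA adB tA tB).
exact: (coset_isomorphic adA adB tA tB).
Qed.

End Converse.

(** * Maximal atlases *)

Section Structures.
Context {R : realType} {M : topologicalType} {r : diff_order}.
Implicit Types (A B : set (chart R M)) (theta chi : chart R M).

Lemma Cr_compatible_sym theta chi : Cr_compatible r theta chi -> Cr_compatible r chi theta.
Proof. by move=> /Cr_compatibleP C; apply/Cr_compatibleP => m d1 d2; case: (C m d2 d1). Qed.

Lemma Cr_compatible_refl theta : Cr_compatible r theta theta.
Proof. by apply/Cr_compatibleP => m d1 _; split; exact: Cr_rep_id. Qed.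

Lemma Cr_compatible_trans A theta chi :
  (forall m, exists2 phi, A phi & chart_dom phi m) ->
  (forall phi, A phi -> Cr_compatible r theta phi) ->
  (forall phi, A phi -> Cr_compatible r phi chi) -> Cr_compatible r theta chi.
Proof.
move=> covA tA Ac; apply/Cr_compatibleP => m dt dc; have [phi Ap dp] := covA m.
have [C1 C2] := (Cr_compatibleP r theta phi).1 (tA _ Ap) m dt dp.
have [C3 C4] := (Cr_compatibleP r phi chi).1 (Ac _ Ap) m dp dc.
by split; [apply: (Cr_rep_comp (psi := phi) (h := id) (k := id)) => // |
           apply: (Cr_rep_comp (psi := phi) (h := id) (k := id)) => //]; exact: cvg_id.
Qed.

Lemma structure_generated A : is_Cr_atlas r A -> exists2 B, Cr_structures R M r B & A `<=` B.
Proof.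
move=> [covA compA].
pose B := [set theta | forall phi, A phi -> Cr_compatible r theta phi].
have AB : A `<=` B by move=> theta At phi Ap; exact: compA.
exists B => //; split.
  split=> [m|theta chi Bt Bc].
    by have [phi Ap dm] := covA m; exists phi => //; exact: AB.
  apply: Cr_compatible_trans covA Bt _ => phi Ap.
  exact/Cr_compatible_sym/Bc.
move=> C [_ compC] BC; apply/seteqP; split=> // theta Ct phi Ap.
by apply: compC => //; exact/BC/AB.
Qed.

Lemma structure_mem A theta : Cr_structures R M r A ->
  (forall phi, A phi -> Cr_compatible r theta phi) -> A theta.
Proof.
move=> [[covA compA] maxA] tA.
have <- : A `|` [set theta] = A; last by right.
apply: maxA; last by move=> phi; left.
split=> [m|phi chi [Ap|->] [Ac|->]].
- by have [phi Ap dm] := covA m; exists phi => //; left.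
- exact: compA.
- exact/Cr_compatible_sym/tA.
- exact: tA.
- exact: Cr_compatible_refl.
Qed.

End Structures.

(** * Adapted atlases and realisation of transition maps *)

(** A monotone surjection has no jumps. This gives continuity at 0 of a diffeomorphism of R_pos
    extended by the identity. *)
Lemma increasing_bij_continuous {R : realType} (H G : R -> R) :
  {homo H : x y / x < y} -> cancel H G -> cancel G H -> continuous H.
Proof.
move=> mH HK GK x.
have mHle : {mono H : x y / x <= y} by exact: le_mono.
have ab : x - 1 <= x + 1 by lra.
have : {within `[x - 1, x + 1], continuous H}.
  apply: segment_inc_surj_continuous; first by move=> u v _ _; exact: mHle.
  move=> y /=; rewrite in_itv /= => /andP[y1 y2]; exists (G y); last exact: GK.
  by rewrite /= in_itv /= -mHle -[_ <= x + 1]mHle GK y1 y2.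
move=> /(continuous_subspaceW (@subset_itv_oo_cc _ _ (x - 1) (x + 1))).
rewrite continuous_open_subspace; last exact: interval_open.
by apply; rewrite inE /= in_itv /=; apply/andP; split; lra.
Qed.

Section Existence.
Context {R : realType} {r : diff_order}.
Hypothesis r0 : r <> Some 0%N.

Lemma sheet_chart b (H G : R -> R) :
  continuous H -> continuous G -> cancel H G -> cancel G H ->
  exists phi : chart R (Yspace R), [/\ chart_dom phi = YS b, chart_cod phi = setT,
    chart_fun phi = H \o @Yproj R & chart_inv phi = @sheet R b \o G].
Proof.
move=> cH cG HK GK.
have cHp : continuous (H \o @Yproj R).
  by move=> m; apply: continuous_comp; [exact: Yproj_continuous | exact: cH].
have csG : continuous (@sheet R b \o G).
  by move=> y; apply: continuous_comp; [exact: cG | exact: sheet_continuous].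
have hom : homeo (@YS R b) setT (H \o @Yproj R) (@sheet R b \o G).
  split.
  - by [].
  - by move=> y _; rewrite YSE; exists (G y).
  - by move=> m /set_mem; rewrite YSE => -[x _ <-] /=; rewrite sheetK HK.
  - by move=> y _ /=; rewrite sheetK GK.
  - by split; exact: continuous_subspaceT.
by exists (Chart (@YS_open R b) openT hom).
Qed.

(** The global coordinate of each sheet is increasing with value 0 at the origin, so it takes W onto
    R_pos; maximality of [A] makes it a chart of [A]. *)
Lemma adapted_exists A : Cr_structures R (Yspace R) r A ->
  exists phi, adapted_charts (r := r) A phi.
Proof.
move=> SA; suff /choice[phi phiP] : forall b, exists phi,
    A phi /\ adapted_chart (@YS R b) phi.
  by exists phi; split=> // b; case: (phiP b).
move=> b; have [H [G [HK GK [cH cG] [mH H0] C]]] := line_parametrization r0 SA.1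
  (@sheet_continuous R b) (@Yproj_continuous R) (@sheetK R b) (@sheet_range_open R b).
have [phi [domE codE funE invE]] := sheet_chart b cH cG HK GK.
exists phi; split.
  apply: (structure_mem SA) => theta At; apply/Cr_compatibleP => m.
  rewrite domE YSE => -[t _ <-] dt; have [C1 C2] := C theta t At dt.
  by rewrite /Cr_rep funE invE; split; [rewrite /= sheetK; exact: C2 | exact: C1].
have mono : {mono H : x y / x < y} by exact: leW_mono (le_mono mH).
split=> //; apply/seteqP; split=> [_ [m Wm <-]|y y0].
  rewrite funE /= /Rpos /= -[ltLHS]H0 mono -(YW_sheet b).
  by rewrite sheet_projK// -YSE; exact: YW_YS.
exists (sheet b (G y)); last by rewrite funE /= sheetK GK.
by apply/YW_sheet; rewrite -mono H0 GK.
Qed.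

Lemma ext_pos_homo (f : posdiffeo R r) x y : 0 < x -> x < y -> ext_pos f x < ext_pos f y.
Proof.
move=> x0 xy; have [u uE] := Rpos_val x0; have [v vE] := Rpos_val (lt_trans x0 xy).
by move: xy; rewrite uE vE !ext_pos_val; exact: pd_orientation.
Qed.

Definition extend_by_id (f : posdiffeo R r) (x : R) := if 0 < x then ext_pos f x else x.

Lemma extend_by_id_homo (f : posdiffeo R r) : {homo extend_by_id f : x y / x < y}.
Proof.
move=> x y xy; rewrite /extend_by_id; case: ifPn => [x0|].
  by rewrite (lt_trans x0 xy); exact: ext_pos_homo.
rewrite -leNgt => x0; case: ifP => // y0; apply: (le_lt_trans x0).
exact: ext_pos_fun.
Qed.

Lemma extend_by_idK (f : posdiffeo R r) : cancel (extend_by_id f) (extend_by_id (f^-1)%g).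
Proof.
move=> x; rewrite /extend_by_id; case: (ltP 0 x) => [x0|]; last by rewrite leNgt => /negbTE ->.
have [u ->] := Rpos_val x0; rewrite ext_pos_val (valP (f u)) ext_pos_val.
by congr val; exact: pd_funK.
Qed.

Lemma extend_by_id_Cr (f : posdiffeo R r) x : 0 < x -> Cr_at r (extend_by_id f) x.
Proof.
move=> x0; have Cf : Cr_at r (ext_pos f) x.
  by exists (@Rpos R); split; [exact: open_Rpos | exact: x0 | exact: pd_fun_Cr].
apply: Cr_at_near Cf; have : \forall y \near x, 0 < y by exact: lt_nbhsr.
by apply: filterS => y y0; rewrite /extend_by_id y0.
Qed.

(** The charts of the two sheets overlap only in W, so the regularity of the extension of g is
    tested at positive points alone and its corner at 0 is harmless. *)
Lemma transition_realized (g : posdiffeo R r) : exists A phi,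
  adapted_charts (r := r) A phi /\ transition_of (phi false) (phi true) g.
Proof.
pose E b := if b then extend_by_id g else id.
pose E' b := if b then extend_by_id (g^-1)%g else id.
have EK b : cancel (E b) (E' b) by case: b => //; exact: extend_by_idK.
have E'K b : cancel (E' b) (E b).
  by case: b => //; have := @extend_by_idK (g^-1)%g; rewrite invgK.
have mE b : {homo E b : x y / x < y} by case: b => //; exact: extend_by_id_homo.
have mE' b : {homo E' b : x y / x < y} by case: b => //; exact: extend_by_id_homo.
have Epos b x : 0 < E b x <-> 0 < x.
  case: b; last by split.
  rewrite /E /extend_by_id; case: ifP => x0; last by rewrite x0.
  by split=> // _; exact: ext_pos_fun.
have chartE b := sheet_chart b (increasing_bij_continuous (@mE b) (EK b) (E'K b))
  (increasing_bij_continuous (@mE' b) (E'K b) (EK b)) (EK b) (E'K b).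
have /choice[phi phiP] := chartE.
have ad b : adapted_chart (YS b) (phi b).
  have [domE codE funE invE] := phiP b; split=> //; apply/seteqP; split=> [_ [m Wm <-]|y y0].
    rewrite funE /= /Rpos /=; apply/(Epos b); rewrite -(YW_sheet b).
    by rewrite sheet_projK// -YSE; exact: YW_YS.
  exists (sheet b (E' b y)); last by rewrite funE /= sheetK E'K.
  by apply/YW_sheet/(Epos b); rewrite E'K.
have CE b x : 0 < x -> Cr_at r (E b) x.
  by case: b => x0; [exact: extend_by_id_Cr | exact: Cr_at_id].
have CE' b x : 0 < x -> Cr_at r (E' b) x.
  by case: b => x0; [exact: extend_by_id_Cr | exact: Cr_at_id].
have rep b c m : YW m -> Cr_rep r (phi b) (phi c) id m.
  move=> Wm; have [x xE] : exists x, m = sheet b x.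
    by exists (Yproj m); rewrite sheet_projK// -YSE; exact: YW_YS.
  have x0 : 0 < x by move: Wm; rewrite xE => /YW_sheet.
  rewrite /Cr_rep; have [_ _ -> _] := phiP c; have [_ _ -> ->] := phiP b.
  have -> : (E c \o @Yproj R) \o id \o (sheet b \o E' b) = E c \o E' b.
    by apply/funext => y; rewrite /= sheetK.
  rewrite xE /= sheetK; apply: Cr_at_comp; first by apply/CE'/Epos.
  by rewrite EK; exact: CE.
have [|A SA subA] := @structure_generated R (Yspace R) r (range phi).
  split=> [m|_ _ [b _ <-] [c _ <-]].
    have [b Sm] := YS_cover m; exists (phi b); first by exists b.
    exact/(adapted_dom (ad b)).
  (* A chart is compared with itself by reflexivity, since [rep] covers only points of W. *)
  have [->|bc] := eqVneq b c; first exact: Cr_compatible_refl.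
  apply/Cr_compatibleP => m /(adapted_dom (ad b)) Sb /(adapted_dom (ad c)) Sc.
  have Wm : YW m by apply/YWP => d; case: b c d bc Sb Sc => [] [] [].
  by split; exact: rep.
exists A, phi; split.
  by split=> // b; apply: subA; exists b.
move=> u; have [_ _ -> _] := phiP true; have [_ _ _ ->] := phiP false.
by rewrite /= sheetK /extend_by_id (valP u) ext_pos_val.
Qed.

End Existence.

(** * Power maps and the classification *)

Section Powers.
Context {R : realType} {r : diff_order}.
Hypothesis r0 : r <> Some 0%N.

Lemma Cr_on_powR s a : Cr_on s (@Rpos R) (fun x => x `^ a).
Proof.
suff Cn n : Cn_on n (@Rpos R) (fun x => x `^ a) by case: s.
have dpow b (x : R) : Rpos x -> is_derive x 1 (fun x => x `^ b) (b * x `^ (b - 1)).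
  exact: is_derive1_powR.
elim: n a => [|n IHn] a.
  split; [by [] | apply: derivable_in_continuous => x x0].
  by case: (dpow a x x0).
apply/Cn_onS; split=> [x x0|]; first by case: (dpow a x x0).
apply: (@eq_Cn_on _ n _ (cst a * (fun x => x `^ (a - 1))) _ open_Rpos).
  by move=> x /set_mem x0; rewrite derive1E; case: (dpow a x x0) => _ ->.
exact: (Cn_on_mul open_Rpos (Cn_on_cst _ _ _) (IHn _)).
Qed.

Lemma powR_lt a (x y : R) : 0 < a -> 0 < x -> x < y -> x `^ a < y `^ a.
Proof.
by move=> a0 x0 xy; apply: gt0_ltr_powR => //; rewrite nnegrE ltW// (lt_trans x0).
Qed.

Lemma powRK a (x : R) : a != 0 -> 0 < x -> (x `^ a) `^ a^-1 = x.
Proof. by move=> a0 x0; rewrite -powRrM divff// powRr1// ltW. Qed.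

Lemma powR_posdiffeo a : 0 < a -> exists g : posdiffeo R r,
  (forall u, val (g u) = val u `^ a) /\ (forall u, val (pd_inv g u) = val u `^ a^-1).
Proof.
move=> a0; apply: (@posdiffeo_of R r (fun x => x `^ a) (fun x => x `^ a^-1)).
- exact: Cr_on_powR.
- exact: Cr_on_powR.
- move=> x x0; split; rewrite ?powR_gt0 ?powRK ?gt_eqF//.
  by rewrite -{2}(invrK a) powRK ?invr_eq0 ?gt_eqF.
- by move=> x y; exact: powR_lt.
Qed.

Lemma powR_small c (eps : R) : 0 < c -> 0 < eps ->
  exists2 d, 0 < d & forall x, 0 < x -> x < d -> x `^ c < eps.
Proof.
move=> c0 e0; exists (eps `^ c^-1); first exact: powR_gt0.
move=> x x0 xe; have := powR_lt c0 x0 xe.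
by rewrite -powRrM mulVf ?gt_eqF// powRr1// ltW.
Qed.

Lemma linear_bound (F : R -> R) : derivable F 0 1 -> F 0 = 0 ->
  exists C d, [/\ 0 < C, 0 < d & forall x, 0 < x -> x < d -> F x <= C * x].
Proof.
move=> /derivableP/is_derive1_caratheodory[u [Fu cu _]] F0.
have nC : \forall x \near 0, u x < `|u 0| + 1.
  by apply: cvgr_lt cu _ _; rewrite ltr_pwDr// ler_norm.
have [d /= d0 dP] := nC.
(* The constant is positive and lies above the slope [u 0], hence bounds the slopes near 0. *)
exists (`|u 0| + 1), d; split; [by rewrite ltr_wpDl | exact: d0 | move=> x x0 xd].
have := Fu x; rewrite F0 !subr0 => ->; rewrite ler_pM2r//.
by apply/ltW/dP; rewrite /= sub0r normrN gtr0_norm.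
Qed.

(** If F 0 were negative, the value F 0 / 2 would be taken to the right of 0, where F is
    positive. *)
Lemma pos_extension0 (F G : R -> R) : cancel F G -> cancel G F ->
  continuous F -> (forall x, 0 < F x <-> 0 < x) -> F 0 = 0.
Proof.
move=> FK GK cF pF; have mF := pos_increasing cF (can_inj FK) pF.
have F0 : F 0 <= 0 by rewrite leNgt; apply/negP => /pF; rewrite ltxx.
apply/eqP; move: F0; rewrite le_eqVlt => /orP[//|F0].
have h : F 0 < F (G (F 0 / 2)) by rewrite GK; lra.
have : 0 < G (F 0 / 2).
  rewrite ltNge; apply/negP; rewrite le_eqVlt => /orP[/eqP e|/mF].
    by move: h; rewrite e ltxx.
  by move/(lt_trans h); rewrite ltxx.
by move/pF; rewrite GK; lra.
Qed.

(** Near 0 the bounds give x^beta <= C D^alpha x^alpha. If beta < alpha, this bounds x^(alpha -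
    beta) below by a positive constant, which fails as x tends to 0. *)
Lemma exponent_le (F G : R -> R) (C D d d' alpha beta : R) :
  0 < alpha -> 0 < beta -> 0 < C -> 0 < D -> 0 < d -> 0 < d' ->
  (forall x, 0 < x -> 0 < G x) ->
  (forall x, 0 < x -> x < d -> F x <= C * x) ->
  (forall x, 0 < x -> x < d' -> G x <= D * x) ->
  (forall x, 0 < x -> x `^ beta = F ((G x) `^ alpha)) -> alpha <= beta.
Proof.
move=> a0 b0 C0 D0 d0 d'0 G0 FC GD E; rewrite leNgt; apply/negP => ba.
have ab0 : 0 < alpha - beta by rewrite subr_gt0.
have K0 : 0 < C * D `^ alpha by rewrite mulr_gt0// powR_gt0.
have [d1 d10 h1] := powR_small a0 d0.
have iK0 : 0 < (C * D `^ alpha)^-1 by rewrite invr_gt0.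
have [d2 d20 h2] := powR_small ab0 iK0.
(* The bound [d'] allows the estimate of G, [d1] brings (D x)^alpha below [d] for the estimate of F,
   and [d2] gives the contradiction. *)
have [x [x0 xd' xd1 xd2]] : exists x : R, [/\ 0 < x, x < d', D * x < d1 & x < d2].
  near (0 : R)^'+ => x; exists x; split=> //; try by near: x; exact: nbhs_right_lt.
  rewrite mulrC -ltr_pdivlMr//; near: x; apply: nbhs_right_lt; exact: divr_gt0.
have Dx0 : 0 < D * x by exact: mulr_gt0.
have Gx := GD _ x0 xd'; have Gx0 := G0 _ x0.
have Ga : (G x) `^ alpha <= (D * x) `^ alpha.
  by apply: ge0_ler_powR => //; rewrite ?nnegrE ltW.
have : x `^ beta <= C * (D * x) `^ alpha.
  rewrite E//; apply: (@le_trans _ _ (C * (G x) `^ alpha)); last by rewrite ler_pM2l.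
  apply: FC; first exact: powR_gt0.
  exact: le_lt_trans Ga (h1 _ Dx0 xd1).
rewrite powRM ?(ltW D0) ?(ltW x0)// mulrA.
have -> : alpha = (alpha - beta) + beta by ring.
rewrite [x `^ (_ + beta)]powRD; last by rewrite (gt_eqF x0) implybT.
have -> : alpha - beta + beta = alpha by ring.
rewrite mulrA -[leLHS]mul1r ler_pM2r ?powR_gt0// leNgt => /negP; apply.
by rewrite mulrC -ltr_pdivlMr// div1r; exact: h2.
Unshelve. all: by end_near. Qed.

Lemma extendable_exponents (w0 w1 : posdiffeo R r) (alpha beta : R) :
  extendable w0 -> extendable w1 -> 0 < alpha -> 0 < beta ->
  (forall u, val (w0 u) `^ beta = ext_pos w1 (val u `^ alpha)) -> alpha = beta.
Proof.
move=> /extendableE[F0 [G0 [CF0 CG0 FK0 GK0 [pF0 Fw0]]]].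
move=> /extendableE[F1 [G1 [CF1 CG1 FK1 GK1 [pF1 Fw1]]]] a0 b0 E.
have {}E x : 0 < x -> F0 x `^ beta = F1 (x `^ alpha).
  move=> x0; have [u ->] := Rpos_val x0; rewrite Fw0 E.
  have [v ->] : exists v : posR R, val u `^ alpha = val v.
    by apply: Rpos_val; rewrite /Rpos /= powR_gt0// (valP u).
  by rewrite ext_pos_val Fw1.
have bnd (F G : R -> R) : (forall x, Cr_at r F x) -> (forall x, Cr_at r G x) ->
    cancel F G -> cancel G F -> (forall x, 0 < F x <-> 0 < x) ->
    exists C d, [/\ 0 < C, 0 < d & forall x, 0 < x -> x < d -> F x <= C * x].
  move=> CF CG FK GK pF; apply: linear_bound; first exact: Cr_at_derivable r0 (CF 0).
  by apply: pos_extension0 FK GK _ pF => x; exact: Cr_at_continuous (CF x).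
have inv_pos (F G : R -> R) : cancel G F -> (forall x, 0 < F x <-> 0 < x) ->
    forall x, 0 < G x <-> 0 < x.
  by move=> GK pF x; rewrite -pF GK.
have pG0 := inv_pos _ _ GK0 pF0; have pG1 := inv_pos _ _ GK1 pF1.
have [C0 [d0 [? ? B0]]] := bnd _ _ CF0 CG0 FK0 GK0 pF0.
have [C1 [d1 [? ? B1]]] := bnd _ _ CF1 CG1 FK1 GK1 pF1.
have [D0 [e0 [? ? B0']]] := bnd _ _ CG0 CF0 GK0 FK0 pG0.
have [D1 [e1 [? ? B1']]] := bnd _ _ CG1 CF1 GK1 FK1 pG1.
(* Substituting x = G0 y in [E] gives y^beta = F1 ((G0 y)^alpha); applying G1 to [E] gives x^alpha =
   G1 ((F0 x)^beta). *)
apply/eqP; rewrite eq_le; apply/andP; split.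
  apply: (exponent_le (F := F1) (G := G0)) B1 B0' _ => //.
  - by move=> x /pG0.
  - by move=> x x0; rewrite -E ?GK0//; apply/pG0.
apply: (exponent_le (F := G1) (G := F0)) B1' B0 _ => //.
- by move=> x /pF0.
- by move=> x x0; rewrite E// FK1.
Qed.

Lemma powR_cosets (a b : R) (ga gb : posdiffeo R r) : 1 < a -> 1 < b ->
  (forall u, val (ga u) = val u `^ a) ->
  (forall u, val (gb u) = val u `^ b) /\ (forall u, val (pd_inv gb u) = val u `^ b^-1) ->
  pm_double_coset (@extendable R r) ga gb -> a = b.
Proof.
move=> a1 b1 gaE [gbE gbVE].
have a0 : 0 < a by lra. have b0 : 0 < b by lra.
move=> /(pm_double_cosetP (@extendableV R r))[c [w0 [w1 [Ww0 Ww1 E]]]].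
have {}E u : pd_pow gb c (w0 u) = w1 (ga u) by exact: (congr1 (fun g : posdiffeo R r => g u) E).
have {}E u : val (pd_pow gb c (w0 u)) = ext_pos w1 (val u `^ a).
  by rewrite E -gaE ext_pos_val.
case: c E => E.
  have bi0 : 0 < b^-1 by rewrite invr_gt0.
  (* The branch of the inverse: both exponents exceed 1, so this is absurd. *)
  have ab : a = b^-1.
    apply: (extendable_exponents Ww0 Ww1 a0 bi0) => u.
    by rewrite -E -gbVE.
  have : b^-1 < 1 by rewrite invf_lt1.
  by rewrite -ab; lra.
by apply: (extendable_exponents Ww0 Ww1 a0 b0) => u; rewrite -E -gbE.
Qed.

End Powers.

(** Countable sets are Lebesgue null, while ]1, 2[ has measure 1. *)
Lemma uncountable_gt1 (R : realType) : ~ countable [set a : R | 1 < a].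
Proof.
move=> cA; have cI : countable `]1 : R, 2[.
  apply: sub_countable cA; apply: subset_card_le => x.
  by rewrite /= in_itv /= => /andP[].
have := countable_lebesgue_measure0 cI; rewrite lebesgue_measure_itv /=.
rewrite lte_fin ltr1n -EFinB => -[] /eqP; rewrite subr_eq0 => /eqP h.
by have /= := ltr1n R 2; rewrite h ltxx.
Qed.

(** * Isomorphism classes and the bijection *)

Section IsoClasses.
Context {R : realType} {r : diff_order}.
Implicit Types (A B : set (chart R (Yspace R))).

Lemma adapted_atlas_charts A (phi psi : chart R (Yspace R)) : adapted_atlas r A phi psi ->
  adapted_charts (r := r) A (fun b => if b then psi else phi).
Proof. by move=> [SA Aphi Apsi adphi adpsi]; split=> // -[]. Qed.

(** Symmetry and transitivity of isomorphism are inherited from equality of double cosets, once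
    adapted charts are chosen on the third structure. *)
Lemma Cr_iso_class_eq A B phi psi gA gB :
  adapted_charts (r := r) A phi -> adapted_charts (r := r) B psi ->
  r <> Some 0%N ->
  transition_of (phi false) (phi true) gA -> transition_of (psi false) (psi true) gB ->
  Cr_iso_class r A = Cr_iso_class r B <->
  pm_double_coset (@extendable R r) gA = pm_double_coset (@extendable R r) gB.
Proof.
move=> adA adB r0 tA tB; split=> [AB|AB].
  have [_ /(isomorphic_cosetP adA adB tA tB)//] : Cr_iso_class r A B.
  rewrite AB; split; first by case: adB.
  exact/(isomorphic_cosetP adB adB tB tB).
apply/seteqP; split=> C [SC]; have [chi adC] := adapted_exists r0 SC.
  have [gC tC] := transition_exists adC.
  move=> /(isomorphic_cosetP adA adC tA tC) AC; split=> //.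
  by apply/(isomorphic_cosetP adB adC tB tC); rewrite -AB.
have [gC tC] := transition_exists adC.
move=> /(isomorphic_cosetP adB adC tB tC) BC; split=> //.
by apply/(isomorphic_cosetP adA adC tA tC); rewrite AB.
Qed.

End IsoClasses.

(* The second conjunct says that every structure contains an atlas of the kind
   that defines Phi, so that the third one determines Phi on all classes. *)
Theorem theorem1p2 (R : realType) (r : diff_order) (hr : r <> Some 0%N) :
  (exists Phi : set (set (chart R (Yspace R))) -> set (posdiffeo R r),
    [/\ set_bij (Cr_iso_classes R (Yspace R) r)
                (pm_double_cosets (@extendable R r)) Phi,
        (forall A, Cr_structures R (Yspace R) r A ->
           exists phi psi, adapted_atlas r A phi psi) &
        (forall A phi psi, adapted_atlas r A phi psi ->
           exists2 g : posdiffeo R r, transition_of phi psi g &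
             Phi (Cr_iso_class r A) = pm_double_coset (@extendable R r) g)]) /\
  (exists S : set (set (chart R (Yspace R))),
    [/\ S `<=` Cr_structures R (Yspace R) r,
        ~ countable S &
        forall A B, S A -> S B -> A <> B -> ~ Cr_isomorphic r A B]).
Proof.
split.
  (* A union over all representatives and adapted charts avoids choices; [PhiE] shows that all of
     them contribute the same double coset. *)
  pose Phi (K : set (set (chart R (Yspace R)))) : set (posdiffeo R r) :=
    [set x | exists A phi g, [/\ adapted_charts (r := r) A phi,
       transition_of (phi false) (phi true) g, K = Cr_iso_class r A &
       pm_double_coset (@extendable R r) g x]].
  have PhiE A phi g : adapted_charts (r := r) A phi ->
      transition_of (phi false) (phi true) g ->
      Phi (Cr_iso_class r A) = pm_double_coset (@extendable R r) g.
    move=> adA tA; apply/seteqP; split=> [x [B [psi [g' [adB tB]]]]|x gx].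
      by move=> /(Cr_iso_class_eq adA adB hr tA tB) ->.
    by exists A, phi, g.
  exists Phi; split.
  - split.
    + move=> _ [A SA <-]; have [phi adA] := adapted_exists hr SA.
      have [g tA] := transition_exists adA.
      by rewrite /= (PhiE _ _ _ adA tA); exists g.
    + move=> _ _ /set_mem[A SA <-] /set_mem[B SB <-].
      have [phi adA] := adapted_exists hr SA; have [g tA] := transition_exists adA.
      have [psi adB] := adapted_exists hr SB; have [g' tB] := transition_exists adB.
      rewrite (PhiE _ _ _ adA tA) (PhiE _ _ _ adB tB).
      by move/(Cr_iso_class_eq adA adB hr tA tB).
    + move=> _ [g _ <-]; have [A [phi [adA tA]]] := transition_realized g.
      exists (Cr_iso_class r A); last exact: PhiE adA tA.
      by exists A => //; case: adA.
  - move=> A SA; have [phi [_ Aphi ad]] := adapted_exists hr SA.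
    by exists (phi false), (phi true); split=> //; [exact: (ad false) | exact: (ad true)].
  - move=> A phi psi ada; have adA := adapted_atlas_charts ada.
    have [g tA] := transition_exists adA.
    by exists g => //; exact: PhiE adA tA.
have /choice[st stP] : forall a : R, exists Ag : set (chart R (Yspace R)) * posdiffeo R r,
    1 < a -> (exists2 phi, adapted_charts (r := r) Ag.1 phi &
                transition_of (phi false) (phi true) Ag.2) /\
             ((forall u, val (Ag.2 u) = val u `^ a) /\
              (forall u, val (pd_inv Ag.2 u) = val u `^ a^-1)).
  move=> a; have [a1|a1] := ltP 1 a; last first.
    (* A default value for a <= 1, where nothing is claimed. *)
    by exists (set0, 1%g) => a1'; move: a1; rewrite leNgt a1'.
  have [g gE] := @powR_posdiffeo R r a (lt_trans ltr01 a1).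
  have [A [phi [adA tA]]] := transition_realized g.
  by exists (A, g) => _; split=> //; exists phi.
have st_inj a b : 1 < a -> 1 < b -> Cr_isomorphic r (st a).1 (st b).1 -> a = b.
  move=> a1 b1.
  have [[phi adA tA] [gaE _]] := stP a a1; have [[psi adB tB] gbE] := stP b b1.
  move=> /(isomorphic_cosetP adA adB tA tB).
  move=> /(pm_double_coset_eq (@extendable1 R r) (@extendableM R r) (@extendableV R r)).
  exact: powR_cosets.
have st_refl a : 1 < a -> Cr_isomorphic r (st a).1 (st a).1.
  by move=> a1; have [[phi adA tA] _] := stP a a1; apply/(isomorphic_cosetP adA adA tA tA).
exists [set (st a).1 | a in [set a : R | 1 < a]]; split.
- by move=> _ [a a1 <-]; have [[phi [SA _ _] _] _] := stP a a1.
(* Equal structures are isomorphic by [st_refl], so a is recovered from its structure and a counting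
   of S would count the reals above 1. *)
- move=> /countable_injP[f finj]; apply: (@uncountable_gt1 R); apply/countable_injP.
  exists (fun a => f (st a).1) => a b /set_mem a1 /set_mem b1 fab.
  apply: (st_inj a b a1 b1); rewrite -(finj _ _ _ _ fab); first exact: st_refl.
    by rewrite inE; exists a.
  by rewrite inE; exists b.
- move=> _ _ [a a1 <-] [b b1 <-] ab iso; apply: ab.
  by rewrite (st_inj a b a1 b1 iso).
Qed.
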